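(* There exists a universal constant $c>0$ such that the following holds. Let $k\ge 1$ be an integer, let $X_0,\dots,X_{k-1}$ be independent integer-valued random variables and let $X=\sum_{j=0}^{k-1}X_j$. Assume that $X$ is strongly monotone and not almost surely equal to a constant, and moreover that $I\neq\{0\}$, where $I=\{\theta\in\mathbb{R}:\mathbb{E}[e^{\theta X}]<\infty\}$. Let $A=\operatorname{ess\,inf}X$ and $B=\operatorname{ess\,sup}X$, let $t$ be an integer with $A<t<B$, and let $\theta$ be the unique real number in the interior of $I$ having $\psi_X'(\theta)=t$, where $\psi_X(\theta)=\log\mathbb{E}[e^{\theta X}]$. Let $Y_0,\dots,Y_{k-1}$ be independent random variables such that $Y_j$ is the exponential tilt of $X_j$ by $\theta$, and let $Y=\sum_{j=0}^{k-1}Y_j$, which is the exponential tilt of $X$ by $\theta$. Then $\mathbb{E}[Y]=t$ and $$\left|\Pr[X=t]-\frac{\mathbb{E}[e^{\theta X}]}{e^{\theta t}}\cdot\frac{1}{\sqrt{2\pi}\,\sigma_Y}\right|\le c\,\frac{\mathbb{E}[e^{\theta X}]}{e^{\theta t}}\cdot\frac{\eta_Y^2}{\sigma_Y^6},$$ where $\sigma_Y^2=\mathrm{Var}[Y]$ and $\eta_Y=\sum_{j=0}^{k-1}\mathbb{E}\left[|Y_j-\mathbb{E}[Y_j]|^3\right]$.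
   Context: For a real random variable $X$, its characteristic function is $f_X(\lambda)=\mathbb{E}[e^{i\lambda X}]$, $\lambda\in\mathbb{R}$. $X$ is called monotone if $\lambda\mapsto|f_X(\lambda)|$ is decreasing (in the weak sense, i.e. non-increasing) on $[0,\pi]$. For an integer-valued random variable $X$, let $I_X=\{\theta\in\mathbb{R}:\mathbb{E}[e^{\theta X}]<\infty\}$, an interval containing $0$. For $\theta\in I_X$, the exponential tilt of $X$ by $\theta$ is the integer-valued random variable $X_\theta$ with distribution $\Pr[X_\theta=s]=\frac{\Pr[X=s]e^{\theta s}}{\mathbb{E}[e^{\theta X}]}$ for $s\in\mathbb{Z}$. $X$ is called strongly monotone if (1) $I_X\neq\{0\}$ and (2) $X_\theta$ is monotone for every $\theta\in I_X$. For independent $X_j$ with sum $X$, $I_X=\bigcap_j I_{X_j}$, so each $X_j$ can be tilted by any $\theta\in I_X$. The essential infimum and supremum are $\operatorname{ess\,inf}X=\sup\{s:\Pr[X<s]=0\}$ and $\operatorname{ess\,sup}X=\inf\{s:\Pr[X>s]=0\}$, with values in $\mathbb{R}\cup\{-\infty,\infty\}$. The function $\psi_X:I\to\mathbb{R}$ is strictly convex and differentiable in the interior of $I$, so there is at most one $\theta$ in the interior of $I$ with $\psi_X'(\theta)=t$. The number $\theta$ is part of the given data of the theorem; its existence is not part of the conclusion. *)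

(* Defs.v *)
From HB Require Import structures.
From mathcomp Require Import all_boot all_order all_algebra.
From mathcomp Require Import all_classical all_reals all_analysis.
From mathcomp Require Import complex.

Set Implicit Arguments.
Unset Strict Implicit.
Unset Printing Implicit Defensive.

Import Order.TTheory GRing.Theory Num.Theory.
Import numFieldNormedType.Exports.

Local Open Scope classical_set_scope.
Local Open Scope ring_scope.
Local Open Scope complex_scope.

Definition int_valued d (T : measurableType d) (R : realType)
    (X : T -> R) : Prop :=
  forall w, X w \is a Num.int.

Definition mutually_independent d (T : measurableType d) (R : realType)
    (P : probability T R) (I : finType) (X : I -> {RV P >-> R}) : Prop :=
  forall (J : {set I}) (B : I -> set R),
    (forall i, i \in J -> measurable (B i)) ->
    P (\bigcap_(i in [set` J]) (X i @^-1` B i)) =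
    (\prod_(i in J) P (X i @^-1` B i))%E.

(* The expectation of a complex random variable is taken componentwise. *)
Definition cexpectation d (T : measurableType d) (R : realType)
    (P : probability T R) (Z : T -> R[i]) : R[i] :=
  fine 'E_P[@complex.Re R \o Z] +i* fine 'E_P[@complex.Im R \o Z].

(* [expi x] is $e^{ix}$. *)
Definition expi (R : realType) (x : R) : R[i] := cos x +i* sin x.

Definition charfun d (T : measurableType d) (R : realType)
    (P : probability T R) (X : {RV P >-> R}) (l : R) : R[i] :=
  cexpectation P (fun w => expi (l * X w)).

Definition monotone_rv d (T : measurableType d) (R : realType)
    (P : probability T R) (X : {RV P >-> R}) : Prop :=
  forall l1 l2 : R, 0 <= l1 -> l1 <= l2 -> l2 <= pi ->
    `|charfun X l2| <= `|charfun X l1|.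

Definition mgf_dom d (T : measurableType d) (R : realType)
    (P : probability T R) (X : {RV P >-> R}) : set R :=
  [set theta | ('M_P X theta < +oo)%E].

(* [Y], possibly living on another probability space, is a realization of the
   exponential tilt of the integer-valued [X] by [theta]; this is meaningful
   for [theta] in [mgf_dom X] only. *)
Definition exp_tilt d (T : measurableType d) d' (T' : measurableType d')
    (R : realType) (P : probability T R) (X : {RV P >-> R}) (theta : R)
    (Q : probability T' R) (Y : {RV Q >-> R}) : Prop :=
  int_valued Y /\
  forall s : int,
    pmf Y s%:~R = pmf X s%:~R * expR (theta * s%:~R) / fine ('M_P X theta).

(* Monotonicity depends on the law only, so quantifying over all realizations
   of the tilt is the same as choosing one; [X] itself, under the probability
   with density $e^{theta X} / E[e^{theta X}]$ with respect to [P], is one. *)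
Definition strongly_monotone d (T : measurableType d) (R : realType)
    (P : probability T R) (X : {RV P >-> R}) : Prop :=
  mgf_dom X <> [set 0] /\
  forall theta : R, mgf_dom X theta ->
    forall (d' : measure_display) (T' : measurableType d')
      (Q : probability T' R) (Y : {RV Q >-> R}),
      exp_tilt X theta Y -> monotone_rv Y.

Definition log_mgf d (T : measurableType d) (R : realType)
    (P : probability T R) (X : {RV P >-> R}) (theta : R) : R :=
  ln (fine ('M_P X theta)).

Definition std_dev d (T : measurableType d) (R : realType)
    (P : probability T R) (X : {RV P >-> R}) : R :=
  Num.sqrt (fine 'V_P[X]).

Definition sum_abs_central_mmt3 d (T : measurableType d) (R : realType)
    (P : probability T R) (k : nat) (X : 'I_k -> {RV P >-> R}) : R :=
  \sum_(j < k) fine 'E_P[fun w => `|X j w - fine 'E_P[X j]| ^+ 3].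

(* Main.v *)
Require Import Defs.
From HB Require Import structures.
From mathcomp Require Import all_boot all_order all_algebra.
From mathcomp Require Import all_classical all_reals all_analysis.
From mathcomp Require Import measurable_realfun ess_sup_inf.
From mathcomp Require Import ring lra zify.
From mathcomp Require Import complex.

Set Implicit Arguments.
Unset Strict Implicit.
Unset Printing Implicit Defensive.

Import Order.TTheory GRing.Theory Num.Theory.
Import numFieldNormedType.Exports.
Import ComplexField.Normc.

Local Open Scope classical_set_scope.
Local Open Scope ring_scope.

(** Tilting turns a probability at an arbitrary integer [t] into a probability
    at the mean: [pmf X t = M * pmf Y t], where the tilt [Y] has mean [t]
    (the cumulant generating function of [X] has slope [t] at [theta]).  So the
    claim is a local limit theorem for [Y] at its mean, with the error
    [eta ^ 2 / sigma ^ 6], and it is proved with characteristic functions.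

    Write [f] for the characteristic function of [Y - t], a product over the
    summands.  Fourier inversion on the integers ([pmf_inversion]) gives
    [2 pi * pmf Y t] as the integral of [Re f] over [[- pi, pi]], while
    [sqrt (2 pi) / sigma] is the integral of the Gaussian
    [exp (- sigma ^ 2 l ^ 2 / 2)] over the line.  Let
    [eps = sigma ^ 2 / (4 eta)].

    - For [l <= eps], a second-order expansion of each factor shows that [f] is
      within [6 eta l ^ 3 exp (- sigma ^ 2 l ^ 2 / 4)] of the Gaussian
      ([prod_charfun_estimates]); integrating gives an error of the order of
      [eta / sigma ^ 4].
    - For [eps <= l <= pi], monotonicity replaces [|f l|] by [|f eps|], which
      the same expansion bounds by [exp (- sigma ^ 2 eps ^ 2 / 4)], hence by
      [64 eta ^ 2 / sigma ^ 6].  This is the only use of strong monotonicity;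
      without it [|f|] could be large far from [0]: for a sum with only even
      values, [|f pi| = 1].
    - The part of the Gaussian integral beyond [eps] is again of the order of
      [eta / sigma ^ 4].

    Since the summands are integer-valued, a third absolute central moment is
    at least half of the variance ([int_variance_le_abs3]), so that
    [sigma ^ 2 <= 2 eta].  Thus [eps < pi], and [eta / sigma ^ 4] is at most
    [2 eta ^ 2 / sigma ^ 6].

    Independence is used in three forms: the product formula for nonnegative
    functions and its bounded complex version ([indep_prod], [indep_cprod]),
    the vanishing of covariances ([indep_pair_Rintegral]), and the joint law,
    which shows that the sum of independent tilts is the tilt of the sum
    ([exp_tilt_sum]).  The moments of the tilts are finite because [theta] is
    interior to the domain of the moment generating function of the sum, hence
    to that of each summand ([mgf_sum_fin]). *)


(** * Taylor estimates *)

Section calculus.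
Variable R : realType.
Implicit Types (x a b u v : R) (f g : R -> R).

(** Starting from [cos <= 1] and [sin <= 1], repeated use of this integration step
    yields the Taylor bounds below. *)
Lemma ge0_of_derive_ge0 f g : f 0 = 0 ->
  (forall x, is_derive x 1 f (g x)) ->
  (forall x, 0 <= x -> 0 <= g x) -> forall x, 0 <= x -> 0 <= f x.
Proof.
move=> f0 fg g0 x; rewrite le_eqVlt => /predU1P[<-|x0]; first by rewrite f0.
have cf : {within `[0, x], continuous f}.
  apply: derivable_within_continuous => y _; exact: ex_derive.
have [c + fx] := MVT x0 (fun y _ => fg y) cf.
rewrite in_itv/= => /andP[c0 cx].
by rewrite f0 subr0 in fx; rewrite fx subr0 mulr_ge0 ?g0 // ltW.
Qed.

Lemma sin_le x : 0 <= x -> sin x <= x.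
Proof.
move=> x0; rewrite -subr_ge0.
apply: (@ge0_of_derive_ge0 (id - @sin R) (fun y => 1 - cos y)) x0.
- by rewrite !fctE sin0 subr0.
- by move=> y y0; rewrite subr_ge0 cos_le1.
Qed.

Lemma cos_ge1B x : 0 <= x -> 1 - x <= cos x.
Proof.
move=> x0.
have := @ge0_of_derive_ge0 (@cos R + (id - cst 1)) (fun y => 1 - sin y) _ _ _ x x0.
rewrite !fctE cos0 => h; have {h} : 0 <= cos x + (x - 1); last lra.
apply: h.
- by ring.
- by move=> y; apply: is_derive_eq; ring.
- by move=> y y0; rewrite subr_ge0 sin_le1.
Qed.

Lemma sin_geBsqr x : 0 <= x -> x - x ^+ 2 / 2 <= sin x.
Proof.
move=> x0.
have := @ge0_of_derive_ge0 (@sin R + (2^-1 *: (id ^+ 2) - id))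
  (fun y => cos y + (y - 1)) _ _ _ x x0.
rewrite !fctE sin0 /GRing.scale/= => h.
have {h} : 0 <= sin x + (2^-1 * x ^+ 2 - x); last lra.
apply: h.
- by ring.
- by move=> y; apply: is_derive_eq; rewrite /GRing.scale/=; field.
- by move=> y y0; have := cos_ge1B y0; lra.
Qed.

Lemma cos_ge1Bsqr x : 0 <= x -> 1 - x ^+ 2 / 2 <= cos x.
Proof.
move=> x0.
have := @ge0_of_derive_ge0 (@cos R + (2^-1 *: (id ^+ 2) - cst 1))
  (fun y => y - sin y) _ _ _ x x0.
rewrite !fctE cos0 /GRing.scale/= => h.
have {h} : 0 <= cos x + (2^-1 * x ^+ 2 - 1); last lra.
apply: h.
- by ring.
- by move=> y; apply: is_derive_eq; rewrite /GRing.scale/=; field.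
- by move=> y y0; have := sin_le y0; lra.
Qed.

Lemma cos_le_cube x : 0 <= x -> cos x <= 1 - x ^+ 2 / 2 + x ^+ 3 / 6.
Proof.
move=> x0.
have := @ge0_of_derive_ge0 (6^-1 *: (id ^+ 3) - 2^-1 *: (id ^+ 2) + cst 1 - @cos R)
  (fun y => 2^-1 * y ^+ 2 - y + sin y) _ _ _ x x0.
rewrite !fctE cos0 /GRing.scale/= => h.
have {h} : 0 <= 6^-1 * x ^+ 3 - 2^-1 * x ^+ 2 + 1 - cos x; last lra.
apply: h.
- by ring.
- by move=> y; apply: is_derive_eq; rewrite /GRing.scale/=; field.
- by move=> y y0; have := sin_geBsqr y0; lra.
Qed.

Lemma sin_ge_cube x : 0 <= x -> x - x ^+ 3 / 6 <= sin x.
Proof.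
move=> x0.
have := @ge0_of_derive_ge0 (@sin R + (6^-1 *: (id ^+ 3) - id))
  (fun y => cos y + (2^-1 * y ^+ 2 - 1)) _ _ _ x x0.
rewrite !fctE sin0 /GRing.scale/= => h.
have {h} : 0 <= sin x + (6^-1 * x ^+ 3 - x); last lra.
apply: h.
- by ring.
- by move=> y; apply: is_derive_eq; rewrite /GRing.scale/=; field.
- by move=> y y0; have := cos_ge1Bsqr y0; lra.
Qed.

Lemma normr_cos_taylor x : `|cos x - (1 - x ^+ 2 / 2)| <= `|x| ^+ 3 / 6.
Proof.
rewrite -cos_norm -(real_normK (num_real x)); have := cos_ge1Bsqr (normr_ge0 x).
have := cos_le_cube (normr_ge0 x).
have := exprn_ge0 3 (normr_ge0 x); rewrite ler_norml; lra.
Qed.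

Lemma normr_sin_taylor x : `|sin x - x| <= `|x| ^+ 3 / 6.
Proof.
wlog x0 : x / 0 <= x.
  move=> H; have [/H//|/ltW x0] := leP 0 x.
  have := H (- x); rewrite oppr_ge0 sinN normrN => /(_ x0).
  by rewrite -opprD normrN.
rewrite (ger0_norm x0) ler_norml; have := sin_le x0; have := sin_ge_cube x0.
have := exprn_ge0 3 x0; move: (x ^+ 3) => z; lra.
Qed.

Lemma expRN_taylor a : 0 <= a -> `|expR (- a) - (1 - a)| <= a ^+ 2.
Proof.
move=> a0; have e1 := expR_ge1Dx (- a); have e2 := expR_ge1Dx a.
have e3 : expR (- a) * expR a = 1 by rewrite -expRD addNr expR0.
rewrite ger0_norm; last by lra.
have := ler_wpM2l (expR_ge0 (- a)) e2; rewrite e3.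
have : 0 <= a ^+ 3 by exact: exprn_ge0.
move: (expR (- a)) e1 => e e1 h1 h2.
rewrite -(@ler_pM2r _ (1 + a)); last lra.
by rewrite (_ : (e - (1 - a)) * _ = e * (1 + a) - 1 + a ^+ 2); [|ring];
  rewrite (_ : a ^+ 2 * (1 + a) = a ^+ 2 + a ^+ 3); [lra|ring].
Qed.

End calculus.

(** * Products of characteristic functions *)

Section products.
Local Open Scope complex_scope.
Variable R : realType.
Implicit Types (z : R[i]) (u b : R).

Lemma normcB_le z1 z2 : normc (z1 - z2) <= normc z1 + normc z2.
Proof. by have := le_normcD z1 (- z2); rewrite normcN. Qed.

Lemma normc_real u : normc u%:C = `|u|.
Proof. by rewrite /normc /= expr0n /= addr0 sqrtr_sqr. Qed.

Lemma normc_ge0 z : 0 <= normc z.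
Proof. by case: z => x y; exact: sqrtr_ge0. Qed.

Lemma normc_prod_le (I : Type) (s : seq I) (f : I -> R[i]) (w : I -> R) :
  (forall i, normc (f i) <= w i) ->
  normc (\prod_(i <- s) f i) <= \prod_(i <- s) w i.
Proof.
move=> fw; elim: s => [|i s IH]; first by rewrite !big_nil normc1.
by rewrite !big_cons normcM ler_pM ?normc_ge0.
Qed.

(** Telescoping.  The weights [w] dominate both families, so that the error of
    each factor may be measured relatively to its own weight, and the full product
    of weights comes out. *)
Lemma normc_prodB_le (I : Type) (s : seq I) (f g : I -> R[i]) (d w : I -> R) :
  (forall i, normc (f i) <= w i) -> (forall i, normc (g i) <= w i) ->
  (forall i, normc (f i - g i) <= d i * w i) ->
  normc (\prod_(i <- s) f i - \prod_(i <- s) g i) <=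
  (\sum_(i <- s) d i) * \prod_(i <- s) w i.
Proof.
move=> fw gw fgd; elim: s => [|i s IH].
  by rewrite !big_nil subrr normc0 mul0r.
rewrite !big_cons.
set F := \prod_(j <- s) f j; set G := \prod_(j <- s) g j.
set W := \prod_(j <- s) w j; set D := \sum_(j <- s) d j.
rewrite (_ : _ - _ = (f i - g i) * F + g i * (F - G)); last by ring.
apply: (le_trans (le_normcD _ _)); rewrite !normcM.
rewrite (_ : (d i + D) * (w i * W) = d i * w i * W + w i * (D * W)); last by ring.
by rewrite lerD// ler_pM ?normc_ge0 ?normc_prod_le.
Qed.

(** One factor [z] of a characteristic function at [l], for a summand of variance
    [s ^ 2] and third absolute moment [e]: then [u = l * s] and [b = l ^ 3 * e].  If
    [u ^ 2 / 2 <= 1], the quadratic term is in [[0, 1]] and everything follows from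
    the Taylor expansions.  Otherwise [u >= 1], so that [b] dominates [1] and
    [u ^ 2 / 2], and the bounds hold because [|z| <= 1].  This is why no smallness
    of [l] with respect to the single summand is needed. *)
Lemma charfun_factor_estimates z u b : 0 <= u -> u ^+ 3 <= b ->
  normc z <= 1 -> normc (z - (1 - u ^+ 2 / 2)%:C) <= b ->
  [/\ normc z <= expR (- (u ^+ 2 / 2) + b),
      expR (- (u ^+ 2 / 2)) <= expR (- (u ^+ 2 / 2) + b) &
      normc (z - (expR (- (u ^+ 2 / 2)))%:C) <=
        6 * b * expR (- (u ^+ 2 / 2) + b)].
Proof.
move=> u0 u3b z1 zb.
have b0 : 0 <= b by apply: le_trans u3b; exact: exprn_ge0.
set a := u ^+ 2 / 2; set w := expR (- a + b).
have a0 : 0 <= a by rewrite /a; have := sqr_ge0 u; lra.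
have w1 : 1 - a + b <= w by have := expR_ge1Dx (- a + b); rewrite -/w; lra.
have ea1 : expR (- a) <= 1 by rewrite -expR0 ler_expR; lra.
have ea0 := expR_ge0 (- a).
have case_u : a <= 1 /\ a ^+ 2 <= b \/ [/\ 1 < a, a <= b & 1 <= b].
  rewrite /a; have [ua|ua] := leP (u ^+ 2 / 2) 1; [left|right].
    split => //; apply: le_trans u3b.
    have u4 : u <= 4 by nra.
    have : 0 <= u ^+ 3 * (4 - u) by rewrite mulr_ge0 ?exprn_ge0 ?subr_ge0.
    by rewrite (_ : u ^+ 3 * (4 - u) = 4 * u ^+ 3 - u ^+ 4) ?expr_div_n -?exprM; [lra|ring].
  have u1 : 1 <= u by nra.
  have : u ^+ 2 <= u ^+ 3 by rewrite exprS; have := sqr_ge0 u; nra.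
  by split; lra.
split.
- case: case_u => [[a1 ab]|[a1 ab b1]].
    apply: le_trans w1.
    rewrite -[z](subrK ((1 - a)%:C)); apply: (le_trans (le_normcD _ _)).
    by rewrite normc_real ger0_norm; lra.
  by apply: (le_trans z1); rewrite /w -expR0 ler_expR; lra.
- by rewrite /w ler_expR; lra.
- (* a weight is never small, whence the factor [6 = 2 * 3] *)
  have w3 : 1 <= 3 * w.
    have : 1 <= 3 * (1 - a + b); last lra.
    rewrite /a; have [u1|u1] := leP u 1; first by nra.
    by have : u ^+ 2 <= u ^+ 3; [rewrite exprS; have := sqr_ge0 u; nra|lra].
  have : normc (z - (expR (- a))%:C) <= 2 * b; last by nra.
  case: case_u => [[a1 ab]|[a1 ab b1]]; last first.
    apply: (le_trans (normcB_le _ _)).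
    by rewrite normc_real ger0_norm; lra.
  rewrite (_ : z - _ = (z - (1 - a)%:C) - (expR (- a) - (1 - a))%:C); last first.
    by rewrite rmorphB; ring.
  apply: (le_trans (normcB_le _ _)); rewrite normc_real.
  by have := expRN_taylor a0; lra.
Qed.

Lemma prod_charfun_estimates (I : finType) (z : I -> R[i]) (u b : I -> R) :
  (forall i, 0 <= u i) -> (forall i, u i ^+ 3 <= b i) ->
  (forall i, normc (z i) <= 1) ->
  (forall i, normc (z i - (1 - u i ^+ 2 / 2)%:C) <= b i) ->
  let A := (\sum_i u i ^+ 2) / 2 in let B := \sum_i b i in
  normc (\prod_i z i) <= expR (- A + B) /\
  normc (\prod_i z i - (expR (- A))%:C) <= 6 * B * expR (- A + B).
Proof.
move=> u0 ub z1 zb A B.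
have E : expR (- A + B) = \prod_i expR (- (u i ^+ 2 / 2) + b i).
  by rewrite -expR_sum big_split /= sumrN -mulr_suml.
have E' : (expR (- A))%:C = \prod_i (expR (- (u i ^+ 2 / 2)))%:C.
  by rewrite -rmorph_prod -expR_sum sumrN -mulr_suml.
have est i := charfun_factor_estimates (u0 i) (ub i) (z1 i) (zb i).
rewrite E; split; first by apply: normc_prod_le => i; case: (est i).
rewrite E' /B mulr_sumr; apply: normc_prodB_le => i; case: (est i) => // _ h _.
by rewrite normc_real ger0_norm ?expR_ge0.
Qed.

End products.

(** * Expectations of bounded complex functions *)

Section bounded.
Context d (T : measurableType d) (R : realType) (P : probability T R).
Implicit Types (f g : T -> R) (Z W : T -> R[i]).

Definition bounded_mfun f := measurable_fun setT f /\ exists M : R, forall w, `|f w| <= M.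

Lemma bounded_mfun_integrable f : bounded_mfun f -> P.-integrable setT (EFin \o f).
Proof.
move=> [mf [M fM]]; apply: measurable_bounded_integrable => //.
  by rewrite (le_lt_trans (probability_le1 _ _)) ?ltry.
exists M; split; first exact: num_real.
by move=> x Mx w _ /=; apply: le_trans (ltW Mx).
Qed.

Lemma bounded_mfun_cst r : bounded_mfun (fun=> r).
Proof. by split => //; exists `|r|. Qed.

Lemma bounded_mfunD f g : bounded_mfun f -> bounded_mfun g ->
  bounded_mfun (fun w => f w + g w).
Proof.
move=> [mf [M fM]] [mg [N gN]]; split; first exact: measurable_funD.
by exists (M + N) => w; rewrite (le_trans (ler_normD _ _)) ?lerD.
Qed.

Lemma bounded_mfunN f : bounded_mfun f -> bounded_mfun (fun w => - f w).
Proof.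
move=> [mf [M fM]]; split; first exact: measurableT_comp.
by exists M => w; rewrite normrN.
Qed.

Lemma bounded_mfunM f g : bounded_mfun f -> bounded_mfun g ->
  bounded_mfun (fun w => f w * g w).
Proof.
move=> [mf [M fM]] [mg [N gN]]; split; first exact: measurable_funM.
by exists (M * N) => w; rewrite normrM ler_pM.
Qed.

Definition cbounded_mfun Z :=
  bounded_mfun (fun w => complex.Re (Z w)) /\ bounded_mfun (fun w => complex.Im (Z w)).

Local Open Scope complex_scope.

Lemma cexpectationE Z :
  cexpectation P Z = (\int[P]_w complex.Re (Z w)) +i* (\int[P]_w complex.Im (Z w)).
Proof. by rewrite /cexpectation unlock. Qed.

Lemma Rintegral_prob_cst (r : R) : \int[P]_w r = r.
Proof. by rewrite /Rintegral integral_cst//= probability_setT mule1. Qed.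

Lemma cexpectation_cst c : cexpectation P (fun=> c) = c.
Proof.
by case: c => a b; rewrite cexpectationE /= !Rintegral_prob_cst.
Qed.

Lemma cbounded_mfun_cst c : cbounded_mfun (fun=> c).
Proof. by split; exact: bounded_mfun_cst. Qed.

Lemma cbounded_mfunD Z W : cbounded_mfun Z -> cbounded_mfun W ->
  cbounded_mfun (fun w => Z w + W w).
Proof.
move=> [Z1 Z2] [W1 W2]; split.
  rewrite (_ : (fun w => _) = (fun w => complex.Re (Z w) + complex.Re (W w))).
    exact: bounded_mfunD.
  by apply/funext => w; rewrite raddfD.
rewrite (_ : (fun w => _) = (fun w => complex.Im (Z w) + complex.Im (W w))).
  exact: bounded_mfunD.
by apply/funext => w; rewrite raddfD.
Qed.

Lemma cbounded_mfunM Z W : cbounded_mfun Z -> cbounded_mfun W ->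
  cbounded_mfun (fun w => Z w * W w).
Proof.
move=> [Z1 Z2] [W1 W2]; split.
  rewrite (_ : (fun w => _) = (fun w => complex.Re (Z w) * complex.Re (W w) +
    - (complex.Im (Z w) * complex.Im (W w)))).
    by apply: bounded_mfunD; [|apply: bounded_mfunN]; exact: bounded_mfunM.
  by apply/funext => w; case: (Z w) (W w) => a b [].
rewrite (_ : (fun w => _) = (fun w => complex.Re (Z w) * complex.Im (W w) +
    complex.Im (Z w) * complex.Re (W w))).
  by apply: bounded_mfunD; exact: bounded_mfunM.
by apply/funext => w; case: (Z w) (W w) => a b [].
Qed.

Lemma cbounded_mfun_prod (I : Type) (s : seq I) (Z : I -> T -> R[i]) :
  (forall i, cbounded_mfun (Z i)) -> cbounded_mfun (fun w => \prod_(i <- s) Z i w).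
Proof.
move=> cZ; elim: s => [|i s IH].
  by under eq_fun do rewrite big_nil; exact: cbounded_mfun_cst.
by under eq_fun do rewrite big_cons; exact: cbounded_mfunM.
Qed.

Lemma cexpectationD Z W : cbounded_mfun Z -> cbounded_mfun W ->
  cexpectation P (fun w => Z w + W w) = cexpectation P Z + cexpectation P W.
Proof.
move=> [Z1 Z2] [W1 W2]; rewrite !cexpectationE.
rewrite -[RHS]/((_ + _) +i* (_ + _)).
rewrite -!RintegralD//; try exact: bounded_mfun_integrable.
by congr (_ +i* _); apply: eq_Rintegral => w _; rewrite raddfD.
Qed.

Lemma cexpectationZ c Z : cbounded_mfun Z ->
  cexpectation P (fun w => c * Z w) = c * cexpectation P Z.
Proof.
case: c => a b [Z1 Z2]; rewrite !cexpectationE.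
rewrite -[RHS]/((_ - _) +i* (_ + _)).
rewrite -!RintegralZl//; try exact: bounded_mfun_integrable.
have bZ r f : bounded_mfun f -> bounded_mfun (fun w => r * f w).
  by apply: bounded_mfunM; exact: bounded_mfun_cst.
rewrite -RintegralB//; try by apply: bounded_mfun_integrable; exact: bZ.
rewrite -RintegralD//; try by apply: bounded_mfun_integrable; exact: bZ.
by congr (_ +i* _); apply: eq_Rintegral => w _; case: (Z w).
Qed.

End bounded.

(** * Product formulas for independent variables *)

Section slot.
Import HBNNSimple.
Context d (T : measurableType d) d' (T' : measurableType d') (R : realType) (P : probability T R).
Local Open Scope ereal_scope.
Variables (X : T -> T') (H : T -> R).
Hypotheses (mX : measurable_fun setT X) (mH : measurable_fun setT H).
Hypotheses (H0 : forall w, (0 <= H w)%R) (Hfin : \int[P]_w (H w)%:E < +oo).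
Hypothesis indepXH : forall B : set T', measurable B ->
  \int[P]_w (\1_B (X w) * H w)%:E = P (X @^-1` B) * \int[P]_w (H w)%:E.

Let mXB (B : set T') : measurable B -> measurable (X @^-1` B).
Proof. by move=> mB; rewrite -[X @^-1` B]setTI; exact: mX. Qed.

Lemma integral_nnsfun_slot (h : {nnsfun T' >-> R}) :
  \int[P]_w (h (X w) * H w)%:E = \int[P]_w (h (X w))%:E * \int[P]_w (H w)%:E.
Proof.
pose S := finmap.enum_fset (fset_set (range h)).
have hE y : h y = (\sum_(r <- S) (r * \1_(h @^-1` [set r]) y))%R.
  by rewrite fimfunE fsbig_finite.
have mh r : measurable (h @^-1` [set r]) by exact: measurable_funPTI.
have m1 r : measurable_fun setT (fun w => \1_(h @^-1` [set r]) (X w) : R).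
  have mi : measurable_fun setT (\1_(h @^-1` [set r]) : T' -> R) by exact: measurable_indic.
  exact: (measurableT_comp mi mX).
have h0 r y : (0 <= r * \1_(h @^-1` [set r]) y :> R)%R.
  by have := nnfun_muleindic_ge0 h r y; rewrite lee_fin.
under eq_integral do rewrite hE mulr_suml -sumEFin.
rewrite ge0_integral_sum//; last 2 first.
  - move=> r; apply/measurable_EFinP; apply: measurable_funM => //.
    by apply: measurable_funM.
  - by move=> r w _; rewrite lee_fin mulr_ge0.
under [in RHS]eq_integral do rewrite hE -sumEFin.
rewrite ge0_integral_sum//; last 2 first.
  - by move=> r; apply/measurable_EFinP; apply: measurable_funM.
  - by move=> r w _; rewrite lee_fin.
rewrite ge0_sume_distrl; last by move=> r _; apply: integral_ge0 => w _; rewrite lee_fin.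
apply: eq_bigr => r _.
have [r0|r0] := leP 0%R r; last first.
  rewrite [in LHS]integral0_eq; last first.
    by move=> w _; rewrite preimage_nnfun0// indic0 mulr0 mul0r.
  rewrite [X in X * _]integral0_eq ?mul0e// => w _.
  by rewrite preimage_nnfun0// indic0 mulr0.
under eq_integral do rewrite -mulrA EFinM.
rewrite ge0_integralZl_EFin//; last 2 first.
  - by move=> w _; rewrite lee_fin mulr_ge0.
  - by apply/measurable_EFinP; apply: measurable_funM.
rewrite indepXH//.
under [in RHS]eq_integral do rewrite EFinM.
rewrite ge0_integralZl_EFin//; last exact/measurable_EFinP.
rewrite -muleA; congr (_ * (_ * _)).
rewrite -[RHS]/(\int[P]_w (\1_(X @^-1` (h @^-1` [set r])) w)%:E).
by rewrite integral_indic ?setIT//; exact: mXB.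
Qed.

(** The product rule for indicators extends to nonnegative functions by the
    usual approximation with simple functions; finiteness of the integral of [H]
    lets it pass to the limit. *)
Lemma integral_mul_slot (g : T' -> R) : measurable_fun setT g ->
  (forall y, (0 <= g y)%R) ->
  \int[P]_w (g (X w) * H w)%:E = \int[P]_w (g (X w))%:E * \int[P]_w (H w)%:E.
Proof.
move=> mg g0.
have mEg : measurable_fun setT (EFin \o g).
  exact/measurable_EFinP.
pose G := nnsfun_approx measurableT mEg.
have mG n : measurable_fun setT (fun w => G n (X w) : R) by exact: measurableT_comp.
have G0 n y : (0 <= G n y)%R by [].
have Gnd y : {homo (fun n => G n y) : m n / (m <= n)%N >-> (m <= n)%R}.
  by move=> m n mn; have /lefP := nd_nnsfun_approx measurableT mEg mn; exact.
have Gcvg y : (G n y)%:E @[n --> \oo] --> (g y)%:E.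
  have := @cvg_nnsfun_approx _ _ _ _ measurableT _ mEg _ y; apply => // x _.
  by rewrite lee_fin.
have c1 : \int[P]_w (G n (X w))%:E @[n --> \oo] --> \int[P]_w (g (X w))%:E.
  rewrite (_ : \int[P]_w (g (X w))%:E = \int[P]_w limn (fun n => (G n (X w))%:E)).
    apply: cvg_monotone_convergence => //.
    - by move=> n; exact/measurable_EFinP.
    - by move=> n w _; rewrite lee_fin.
    - by move=> w _ m n mn; rewrite lee_fin Gnd.
  by apply: eq_integral => w _; apply/esym/cvg_lim.
have c2 : \int[P]_w (G n (X w) * H w)%:E @[n --> \oo] --> \int[P]_w (g (X w) * H w)%:E.
  rewrite (_ : \int[P]_w (g (X w) * H w)%:E =
      \int[P]_w limn (fun n => (G n (X w) * H w)%:E)).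
    apply: cvg_monotone_convergence => //.
    - by move=> n; apply/measurable_EFinP; exact: measurable_funM.
    - by move=> n w _; rewrite lee_fin mulr_ge0.
    - by move=> w _ m n mn; rewrite lee_fin ler_wpM2r ?Gnd.
  apply: eq_integral => w _; apply/esym/cvg_lim => //.
  by under eq_fun do rewrite EFinM; rewrite EFinM; exact: cvgeZr.
apply: (cvg_unique _ c2) => //.
rewrite (_ : (fun n => _) = (fun n => \int[P]_w (G n (X w))%:E * \int[P]_w (H w)%:E));
  last by apply/funext => n; exact: integral_nnsfun_slot.
by apply: cvgeZr => //; rewrite ge0_fin_numE// integral_ge0// => w _; rewrite lee_fin.
Qed.
End slot.

Section independence.
Context d (T : measurableType d) (R : realType) (P : probability T R).
Variables (I : finType) (X : I -> {RV P >-> R}).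
Hypothesis indepX : mutually_independent X.
Local Open Scope ereal_scope.
Implicit Types (g : I -> R -> R).

Let replace g j (f : R -> R) : I -> R -> R := fun i => if i == j then f else g i.

Let replace_same g j f : replace g j f j = f.
Proof. by rewrite /replace eqxx. Qed.

Let prod_replace g j f w :
  (\prod_i replace g j f i (X i w) = f (X j w) * \prod_(i | i != j) g i (X i w))%R.
Proof.
rewrite (bigD1 j)//= replace_same; congr *%R.
by apply: eq_bigr => i /negbTE ij; rewrite /replace ij.
Qed.

Let eprod_replace g j f :
  \prod_i \int[P]_w (replace g j f i (X i w))%:E =
  \int[P]_w (f (X j w))%:E * \prod_(i | i != j) \int[P]_w (g i (X i w))%:E.
Proof.
rewrite (bigD1 j)//= replace_same; congr *%E.
by apply: eq_bigr => i /negbTE ij; rewrite /replace ij.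
Qed.

Lemma indep_prod_indic (B : I -> set R) : (forall i, measurable (B i)) ->
  \int[P]_w (\prod_i \1_(B i) (X i w))%:E = \prod_i \int[P]_w (\1_(B i) (X i w))%:E.
Proof.
move=> mB.
have E i : \int[P]_w (\1_(B i) (X i w))%:E = P (X i @^-1` B i).
  rewrite -[LHS]/(\int[P]_w (\1_(X i @^-1` B i) w)%:E) integral_indic ?setIT//.
  exact: measurable_funPTI.
under [RHS]eq_bigr do rewrite E.
have -> : \prod_i P (X i @^-1` B i) =
    P (\bigcap_(i in [set` [set: I]%SET]) (X i @^-1` B i)).
  rewrite indepX//; apply: eq_bigl => i; by rewrite finset.inE.
rewrite -[in RHS](setIT (\bigcap_(_ in _) _)) -integral_indic//; last first.
  apply: fin_bigcap_measurable; first exact: finite_finset.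
  by move=> i _; exact: measurable_funPTI.
apply: eq_integral => w _; congr EFin.
have [wB|wB] := pselect (forall i, B i (X i w)).
  rewrite big1 => [|i _]; last by rewrite indicE mem_set//; exact: wB.
  by rewrite indicE mem_set// => i _; exact: wB.
have [i Bi] : exists i, ~ B i (X i w) by apply/existsNP.
rewrite (bigD1 i)//= [in LHS]indicE memNset// mul0r indicE memNset// => h.
by apply: Bi; apply: h; rewrite /= finset.inE.
Qed.

(** Frees one slot: the formula with indicators in position [j] is the
    independence hypothesis of [integral_mul_slot], with the product of the other
    factors as [H]. *)
Lemma indep_prod_slot g j :
  (forall i, measurable_fun setT (g i)) -> (forall i y, (0 <= g i y)%R) ->
  (forall i, i != j -> \int[P]_w (g i (X i w))%:E < +oo) ->
  (forall B, measurable B ->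
    \int[P]_w (\prod_i replace g j (\1_B) i (X i w))%:E =
    \prod_i \int[P]_w (replace g j (\1_B) i (X i w))%:E) ->
  \int[P]_w (\prod_i g i (X i w))%:E = \prod_i \int[P]_w (g i (X i w))%:E.
Proof.
move=> mg g0 gfin indj.
have PE B : measurable B -> \int[P]_w (\1_B (X j w))%:E = P (X j @^-1` B).
  move=> mB; rewrite -[LHS]/(\int[P]_w (\1_(X j @^-1` B) w)%:E).
  by rewrite integral_indic ?setIT//; exact: measurable_funPTI.
have HE : \int[P]_w (\prod_(i | i != j) g i (X i w))%:E =
    \prod_(i | i != j) \int[P]_w (g i (X i w))%:E.
  have := indj setT measurableT; rewrite eprod_replace PE// preimage_setT probability_setT mul1e => <-.
  by apply: eq_integral => w _; rewrite prod_replace indicT mul1r.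
rewrite [RHS](bigD1 j)//= -HE -integral_mul_slot//.
- by apply: eq_integral => w _; rewrite (bigD1 j).
- under eq_fun do rewrite -big_filter.
  by apply: measurable_prod => i _; exact: measurableT_comp.
- by move=> w; apply: prodr_ge0 => i _; exact: g0.
- rewrite HE -ge0_fin_numE; last first.
    by apply: prode_ge0 => i _; apply: integral_ge0 => w _; rewrite lee_fin.
  apply: prode_fin_num => i ij; rewrite ge0_fin_numE ?gfin//.
  by apply: integral_ge0 => w _; rewrite lee_fin.
- move=> B mB; rewrite HE -PE// -eprod_replace -indj//.
  by apply: eq_integral => w _; rewrite prod_replace.
Qed.

(** The slots in [s] are freed one after the other; with [s] empty this is the
    definition of independence. *)
Lemma indep_prod_seq (s : seq I) g :
  (forall i, measurable_fun setT (g i)) -> (forall i y, (0 <= g i y)%R) ->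
  (forall i, \int[P]_w (g i (X i w))%:E < +oo) ->
  (forall i, i \notin s -> exists2 B, measurable B & g i = \1_B) ->
  \int[P]_w (\prod_i g i (X i w))%:E = \prod_i \int[P]_w (g i (X i w))%:E.
Proof.
elim: s g => [|j s IH] g mg g0 gfin gs.
  have /choice[B hB] i : exists B, measurable B /\ g i = \1_B.
    by have [//|B mB gB] := gs i; exists B.
  rewrite (_ : g = fun i => \1_(B i)).
    by apply: indep_prod_indic => i; case: (hB i).
  by apply/funext => i; case: (hB i).
apply: (indep_prod_slot (j := j)) => // B mB; apply: IH.
- by move=> i; rewrite /replace; case: eqP => // _; exact: measurable_indic.
- by move=> i y; rewrite /replace; case: eqP => // _; rewrite indicE.
- move=> i; rewrite /replace; case: eqP => [->|//].
  rewrite -[X in X < _]/(\int[P]_w (\1_(X j @^-1` B) w)%:E).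
  rewrite integral_indic ?setIT//; last exact: measurable_funPTI.
  by rewrite (le_lt_trans (probability_le1 _ _)) ?ltry//; exact: measurable_funPTI.
- move=> i nis; rewrite /replace; case: eqP => [_|/eqP ij]; first by exists B.
  by apply: gs; rewrite inE negb_or ij.
Qed.

(** One factor may have an infinite expectation; with this the moment generating
    function of a sum controls those of its summands. *)
Lemma indep_prod g j :
  (forall i, measurable_fun setT (g i)) -> (forall i y, (0 <= g i y)%R) ->
  (forall i, i != j -> \int[P]_w (g i (X i w))%:E < +oo) ->
  \int[P]_w (\prod_i g i (X i w))%:E = \prod_i \int[P]_w (g i (X i w))%:E.
Proof.
move=> mg g0 gfin; apply: (indep_prod_slot (j := j)) => // B mB.
apply: (indep_prod_seq (s := enum I)).
- by move=> i; rewrite /replace; case: eqP => // _; exact: measurable_indic.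
- by move=> i y; rewrite /replace; case: eqP => // _; rewrite indicE.
- move=> i; rewrite /replace; case: eqP => [->|/eqP ij]; last exact: gfin.
  rewrite -[X in X < _]/(\int[P]_w (\1_(X j @^-1` B) w)%:E).
  rewrite integral_indic ?setIT//; last exact: measurable_funPTI.
  by rewrite (le_lt_trans (probability_le1 _ _)) ?ltry//; exact: measurable_funPTI.
- by move=> i; rewrite mem_enum.
Qed.

End independence.

Section independence_bounded.
Context d (T : measurableType d) (R : realType) (P : probability T R).
Variables (I : finType) (X : I -> {RV P >-> R}).
Hypothesis indepX : mutually_independent X.
Local Open Scope complex_scope.

Lemma cbounded_mfun_comp (h : R -> R[i]) (Y : {RV P >-> R}) :
  cbounded_mfun h -> cbounded_mfun (fun w => h (Y w)).
Proof.
move=> [[m1 [M hM]] [m2 [N hN]]]; split; split.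
- exact: (measurableT_comp m1).
- by exists M => w.
- exact: (measurableT_comp m2).
- by exists N => w.
Qed.

Lemma indep_prod_real (g : I -> R -> R) :
  (forall i, bounded_mfun (g i)) -> (forall i y, 0 <= g i y) ->
  \int[P]_w (\prod_i g i (X i w)) = \prod_i \int[P]_w g i (X i w).
Proof.
move=> bg g0; apply: EFin_inj; rewrite -prodEFin.
have ig i : P.-integrable setT (EFin \o (fun w => g i (X i w))).
  apply: bounded_mfun_integrable; case: (bg i) => mg [M gM].
  by split; [exact: (measurableT_comp mg)|exists M].
have gfin i : (\int[P]_w (g i (X i w))%:E)%E \is a fin_num.
  exact: (integrable_fin_num measurableT (ig i)).
under [RHS]eq_bigr do rewrite /Rintegral fineK ?gfin//.
have <- := @indep_prod_seq _ _ _ _ _ _ indepX (enum I) g; rewrite ?fineK//.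
- rewrite (@indep_prod_seq _ _ _ _ _ _ indepX (enum I) g)//.
  + by apply: prode_fin_num.
  + by move=> i; case: (bg i).
  + by move=> i; rewrite ltey_eq gfin.
  + by move=> i; rewrite mem_enum.
- by move=> i; case: (bg i).
- by move=> i; rewrite ltey_eq gfin.
- by move=> i; rewrite mem_enum.
Qed.

(** A bounded complex function is a complex linear combination of nonnegative
    bounded ones, and both sides are linear in each factor; the slots of [s] are
    freed one after the other. *)
Lemma indep_cprod_seq (s : seq I) (h : I -> R -> R[i]) :
  (forall i, cbounded_mfun (h i)) ->
  (forall i, i \notin s -> exists2 g : R -> R, (forall y, 0 <= g y) &
     h i = fun y => (g y)%:C) ->
  cexpectation P (fun w => \prod_i h i (X i w)) =
  \prod_i cexpectation P (fun w => h i (X i w)).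
Proof.
elim: s h => [|j s IH] h bh hs.
  have /choice[g hg] i : exists g : R -> R, (forall y, 0 <= g y) /\
      h i = fun y => (g y)%:C.
    by have [//|g g0 hg] := hs i; exists g.
  have cE (f : T -> R) : cexpectation P (fun w => (f w)%:C) = (\int[P]_w f w)%:C.
    by rewrite cexpectationE /= /Rintegral integral0.
  have hE i w : h i (X i w) = (g i (X i w))%:C by case: (hg i) => _ ->.
  under eq_fun do under eq_bigr do rewrite hE.
  under eq_fun do rewrite -rmorph_prod.
  rewrite cE indep_prod_real; last 2 first.
  - move=> i; have [[] ] := bh i; case: (hg i) => _ ->//.
  - by move=> i; case: (hg i).
  rewrite rmorph_prod; apply: eq_bigr => i _.
  by under [in RHS]eq_fun do rewrite hE; rewrite cE.
have bhX i := cbounded_mfun_comp (X i) (bh i).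
pose H w := \prod_(i | i != j) h i (X i w).
have bH : cbounded_mfun H.
  rewrite /H; under eq_fun do rewrite -big_filter.
  by apply: cbounded_mfun_prod => i.
pose C := \prod_(i | i != j) cexpectation P (fun w => h i (X i w)).
(* a nonnegative factor in the slot [j] is covered by the induction hypothesis *)
have step (p : R -> R) : bounded_mfun p -> (forall y, 0 <= p y) ->
    cexpectation P (fun w => (p (X j w))%:C * H w) =
    cexpectation P (fun w => (p (X j w))%:C) * C.
  move=> bp p0.
  pose h' i := if i == j then (fun y => (p y)%:C) else h i.
  have h'j : h' j = fun y => (p y)%:C by rewrite /h' eqxx.
  have h'i i : i != j -> h' i = h i by rewrite /h' => /negbTE ->.
  transitivity (cexpectation P (fun w => \prod_i h' i (X i w))).
    congr cexpectation; apply/funext => w; rewrite [RHS](bigD1 j)//= h'j.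
    by congr (_ * _); apply: eq_bigr => i /h'i ->.
  rewrite IH.
  - rewrite (bigD1 j)//= h'j; congr (_ * _).
    by apply: eq_bigr => i /h'i ->.
  - move=> i; rewrite /h'; case: eqP => // _; split => //=.
    exact: bounded_mfun_cst.
  - move=> i nis; rewrite /h'; case: eqP => [_|/eqP ij]; first by exists p.
    by apply: hs; rewrite inE negb_or ij.
have [[m1 [M1 hM1]] [m2 [M2 hM2]]] := bh j.
pose p1 y := complex.Re (h j y) + M1; pose p2 y := complex.Im (h j y) + M2.
have bp1 : bounded_mfun p1.
  by apply: bounded_mfunD; [split => //; exists M1|exact: bounded_mfun_cst].
have bp2 : bounded_mfun p2.
  by apply: bounded_mfunD; [split => //; exists M2|exact: bounded_mfun_cst].
have p10 y : 0 <= p1 y by have := hM1 y; rewrite ler_norml /p1; lra.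
have p20 y : 0 <= p2 y by have := hM2 y; rewrite ler_norml /p2; lra.
pose c0 : R[i] := - Complex (M1 : R) (M2 : R).
have hjE y : h j y = (p1 y)%:C + 'i%C * (p2 y)%:C + c0 * (1 : R)%:C.
  rewrite /p1 /p2 /c0; case: (h j y) => a b /=; simpc; congr (_ +i* _); ring.
rewrite [RHS](bigD1 j)//= -/C.
have bc (p : R -> R) : bounded_mfun p -> cbounded_mfun (fun w => (p (X j w))%:C).
  move=> bp; apply: (@cbounded_mfun_comp (fun y => (p y)%:C)); split => //=.
  exact: bounded_mfun_cst.
have b1 := bc _ bp1; have b2 := bc _ bp2; have b3 := bc _ (bounded_mfun_cst _ 1).
have bZ c Z : cbounded_mfun Z -> cbounded_mfun (fun w : T => c * Z w).
  by apply: cbounded_mfunM; exact: cbounded_mfun_cst.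
transitivity (cexpectation P (fun w => (p1 (X j w))%:C * H w +
   'i%C * ((p2 (X j w))%:C * H w) + c0 * ((1 : R)%:C * H w))).
  congr cexpectation; apply/funext => w; rewrite (bigD1 j)//= hjE -/(H w); ring.
have EH : cexpectation P H = C.
  have := step _ (bounded_mfun_cst _ 1) (fun=> ler01).
  by rewrite cexpectation_cst mul1r; under eq_fun do rewrite mul1r.
rewrite !cexpectationD ?cexpectationZ ?step//; try by
  do ?[apply: cbounded_mfunD | apply: bZ | apply: cbounded_mfunM].
under [in RHS]eq_fun do rewrite hjE.
rewrite !cexpectationD ?cexpectationZ//; try by
  do ?[apply: cbounded_mfunD | apply: bZ | apply: cbounded_mfunM].
rewrite EH cexpectation_cst; ring.
Qed.

Lemma indep_cprod (h : I -> R -> R[i]) :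
  (forall i, cbounded_mfun (h i)) ->
  cexpectation P (fun w => \prod_i h i (X i w)) =
  \prod_i cexpectation P (fun w => h i (X i w)).
Proof.
by move=> bh; apply: (indep_cprod_seq (s := enum I)) => // i; rewrite mem_enum.
Qed.

End independence_bounded.

Section independence_pair.
Context d (T : measurableType d) (R : realType) (P : probability T R).
Variables (I : finType) (X : I -> {RV P >-> R}).
Hypothesis indepX : mutually_independent X.
Variables (i j : I).
Hypothesis ij : i != j.

Lemma indep_pair_ge0 (a b : R -> R) :
  measurable_fun setT a -> measurable_fun setT b ->
  (forall y, 0 <= a y) -> (forall y, 0 <= b y) ->
  (\int[P]_w (a (X i w))%:E < +oo)%E -> (\int[P]_w (b (X j w))%:E < +oo)%E ->
  (\int[P]_w (a (X i w) * b (X j w))%:E =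
   \int[P]_w (a (X i w))%:E * \int[P]_w (b (X j w))%:E)%E.
Proof.
move=> ma mb a0 b0 fa fb.
pose g l := if l == i then a else if l == j then b else fun=> 1.
have gi : g i = a by rewrite /g eqxx.
have gj : g j = b by rewrite /g eq_sym (negbTE ij) eqxx.
have gl l : (l != i) && (l != j) -> g l = fun=> 1.
  by rewrite /g => /andP[/negbTE-> /negbTE->].
have P1 : (\int[P]_w (1 : R)%:E = 1)%E by rewrite integral_cst//= probability_setT mule1.
have ji : (j != i) by rewrite eq_sym.
transitivity (\int[P]_w (\prod_l g l (X l w))%:E)%E.
  apply: eq_integral => w _; congr EFin.
  by rewrite (bigD1 i)//= (bigD1 j)//= big1 ?mulr1 ?gi ?gj// => l /gl ->.
rewrite (@indep_prod _ _ _ _ _ _ indepX g i).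
- rewrite (bigD1 i)//= (bigD1 j)//= big1 ?mule1 ?gi ?gj// => l /gl ->.
  exact: P1.
- by move=> l; rewrite /g; do 2 case: ifP => // _.
- by move=> l y; rewrite /g; do 2 case: ifP => // _.
- move=> l li; rewrite /g (negbTE li); case: eqP => [->//|_].
  by rewrite P1 ltry.
Qed.

Lemma indep_pair_integrable (a b : R -> R) :
  measurable_fun setT a -> measurable_fun setT b ->
  P.-integrable setT (EFin \o (fun w => a (X i w))) ->
  P.-integrable setT (EFin \o (fun w => b (X j w))) ->
  P.-integrable setT (EFin \o (fun w => a (X i w) * b (X j w))).
Proof.
move=> ma mb /integrableP[m1 f1] /integrableP[m2 f2]; apply/integrableP; split.
  by apply/measurable_EFinP/measurable_funM; apply/measurable_EFinP.
under eq_integral do rewrite /= normrM.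
rewrite (@indep_pair_ge0 (fun y => `|a y|) (fun y => `|b y|))//; last 2 first.
- exact: measurableT_comp.
- exact: measurableT_comp.
rewrite lte_mul_pinfty//; first by apply: integral_ge0 => w _; rewrite lee_fin.
by rewrite ge0_fin_numE//; apply: integral_ge0 => w _; rewrite lee_fin.
Qed.

(** Every integrable function is a difference of two nonnegative integrable
    ones, so that the product rule extends from the nonnegative case by
    bilinearity. *)
Lemma indep_pair_Rintegral (a b : R -> R) :
  measurable_fun setT a -> measurable_fun setT b ->
  P.-integrable setT (EFin \o (fun w => a (X i w))) ->
  P.-integrable setT (EFin \o (fun w => b (X j w))) ->
  \int[P]_w (a (X i w) * b (X j w)) = (\int[P]_w a (X i w)) * \int[P]_w b (X j w).
Proof.
have ge0_case (f g : R -> R) : measurable_fun setT f -> measurable_fun setT g ->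
    (forall y, 0 <= f y) -> (forall y, 0 <= g y) ->
    P.-integrable setT (EFin \o (fun w => f (X i w))) ->
    P.-integrable setT (EFin \o (fun w => g (X j w))) ->
    \int[P]_w (f (X i w) * g (X j w)) = (\int[P]_w f (X i w)) * \int[P]_w g (X j w).
  move=> mf mg f0 g0 inf ing.
  have finf := integrable_fin_num measurableT inf.
  have fing := integrable_fin_num measurableT ing.
  rewrite /Rintegral -fineM//; congr fine; rewrite indep_pair_ge0//.
  - by rewrite ltey_eq finf.
  - by rewrite ltey_eq fing.
have pos_int (Y : T -> R) : P.-integrable setT (EFin \o Y) ->
    P.-integrable setT (EFin \o (fun w => `|Y w|)).
  by move=> iY; have := integrable_norm iY.
have left_case (f g : R -> R) : measurable_fun setT f -> measurable_fun setT g ->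
    (forall y, 0 <= g y) ->
    P.-integrable setT (EFin \o (fun w => f (X i w))) ->
    P.-integrable setT (EFin \o (fun w => g (X j w))) ->
    \int[P]_w (f (X i w) * g (X j w)) = (\int[P]_w f (X i w)) * \int[P]_w g (X j w).
  move=> mf mg g0 inf ing.
  have m1 : measurable_fun setT (fun y => `|f y|) by exact: measurableT_comp.
  have m2 : measurable_fun setT (fun y => `|f y| - f y) by exact: measurable_funB.
  have i1 := pos_int _ inf.
  have i2 : P.-integrable setT (EFin \o (fun w => `|f (X i w)| - f (X i w))).
    by have := integrableB measurableT i1 inf.
  have p2 y : 0 <= `|f y| - f y by rewrite subr_ge0 ler_norm.
  transitivity (\int[P]_w (`|f (X i w)| * g (X j w) -
      (`|f (X i w)| - f (X i w)) * g (X j w))).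
    by apply: eq_Rintegral => w _; ring.
  rewrite RintegralB//; last 2 first.
  - exact: (@indep_pair_integrable (fun y => `|f y|)).
  - exact: (@indep_pair_integrable (fun y => `|f y| - f y)).
  rewrite (ge0_case (fun y => `|f y|))// (ge0_case (fun y => `|f y| - f y))//.
  by rewrite RintegralB//; ring.
move=> ma mb ia ib.
have m1 : measurable_fun setT (fun y => `|b y|) by exact: measurableT_comp.
have m2 : measurable_fun setT (fun y => `|b y| - b y) by exact: measurable_funB.
have i1 := pos_int _ ib.
have i2 : P.-integrable setT (EFin \o (fun w => `|b (X j w)| - b (X j w))).
  by have := integrableB measurableT i1 ib.
have p2 y : 0 <= `|b y| - b y by rewrite subr_ge0 ler_norm.
transitivity (\int[P]_w (a (X i w) * `|b (X j w)| -
    a (X i w) * (`|b (X j w)| - b (X j w)))).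
  by apply: eq_Rintegral => w _; ring.
rewrite RintegralB//; last 2 first.
- exact: (@indep_pair_integrable a (fun y => `|b y|)).
- exact: (@indep_pair_integrable a (fun y => `|b y| - b y)).
rewrite (left_case a (fun y => `|b y|))// (left_case a (fun y => `|b y| - b y))//.
by rewrite RintegralB//; ring.
Qed.

End independence_pair.

(** * Exponential tilts of integer-valued variables *)

Section discrete_laws.
Local Open Scope ereal_scope.

Section one_law.
Context d (T : measurableType d) (R : realType) (P : probability T R).
Variables (K : countType) (V : T -> K).
Hypothesis mV : forall k, measurable (V @^-1` [set k]).
Variable G : K -> \bar R.
Hypothesis G0 : forall k, 0 <= G k.

Let F n := if pickle_inv n is Some k then V @^-1` [set k] else set0.

Let mF n : measurable (F n).
Proof. by rewrite /F; case: pickle_inv. Qed.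

Let FE n w : F n w <-> pickle (V w) = n.
Proof.
rewrite /F; case E : (pickle_inv n) => [k|]; split => //=.
- by move=> ->; have := pickle_invK (T:=K) n; rewrite E.
- move=> Vn; have := pickleK_inv (V w).
  by rewrite Vn E => -[].
- move=> Vn; have := pickleK_inv (V w).
  by rewrite Vn E.
Qed.

(** [pickle_inv] rather than [unpickle] enumerates the atoms, so that no atom is
    counted twice. *)
Lemma integral_discrete : \int[P]_w G (V w) =
  \sum_(n <oo) oapp (fun k => G k * P (V @^-1` [set k])) 0 (pickle_inv n).
Proof.
have FT : \bigcup_n F n = setT.
  by apply/seteqP; split => // w _; exists (pickle (V w)) => //; apply/FE.
rewrite -FT ge0_integral_bigcup//; last 2 first.
- rewrite FT => _ Y mY; rewrite setTI.
  rewrite (_ : _ @^-1` Y = \bigcup_(n in [set n | exists w, pickle (V w) = n /\ Y (G (V w))]) F n).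
    by apply: bigcup_measurable => n _.
  apply/seteqP; split => w /=.
    by move=> Yw; exists (pickle (V w)); [exists w|apply/FE].
  by case=> n [w' [<- Yw']] /FE /(pcan_inj (@pickleK K)) /= ->.
- move=> m n _ _ [w [/FE <- /FE <-]] //.
apply: eq_eseriesr => n _.
rewrite (@eq_integral _ _ _ _ _ (fun=> oapp G 0 (pickle_inv n))); last first.
  move=> w; rewrite inE /F; case: pickle_inv => [k /=|//].
  by move=> ->.
rewrite integral_cst//; rewrite /F; case: pickle_inv => [k//|/=].
by rewrite mul0e.
Qed.
End one_law.

Lemma eq_integral_discrete d (T : measurableType d) d' (T' : measurableType d')
    (R : realType) (P : probability T R) (Q : probability T' R)
    (K : countType) (V : T -> K) (W : T' -> K) (G G' : K -> \bar R) :
  (forall k, measurable (V @^-1` [set k])) ->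
  (forall k, measurable (W @^-1` [set k])) ->
  (forall k, 0 <= G k) -> (forall k, 0 <= G' k) ->
  (forall k, G k * P (V @^-1` [set k]) = G' k * Q (W @^-1` [set k])) ->
  \int[P]_w G (V w) = \int[Q]_w G' (W w).
Proof.
move=> mV mW G0 G'0 GG'; rewrite !integral_discrete//.
by apply: eq_eseriesr => n _; case: pickle_inv.
Qed.

End discrete_laws.

Section tilting.
Context d (T : measurableType d) d' (T' : measurableType d') (R : realType)
  (P : probability T R) (Q : probability T' R).

Lemma int_valued_floor dd (U : measurableType dd) (X : U -> R) w :
  int_valued X -> (Num.floor (X w))%:~R = X w.
Proof. by move=> /(_ w); rewrite intrEfloor => /eqP. Qed.

Lemma pmfE dd (U : measurableType dd) (S : probability U R) (X : {RV S >-> R}) r :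
  S (X @^-1` [set r]) = (pmf X r)%:E.
Proof. by rewrite /pmf fineK// fin_num_measure//; exact: measurable_funPTI. Qed.

Lemma floor_fiber dd (U : measurableType dd) (X : U -> R) (k : int) :
  int_valued X -> (fun w => Num.floor (X w)) @^-1` [set k] = X @^-1` [set k%:~R].
Proof.
move=> iX; apply/seteqP; split => w /=; first by move=> <-; rewrite int_valued_floor.
by move=> ->; rewrite intrKfloor.
Qed.

Lemma integral_gt0 dd (U : measurableType dd) (S : probability U R) (f : U -> R) :
  measurable_fun setT f -> (forall w, 0 < f w) -> (0 < \int[S]_w (f w)%:E)%E.
Proof.
move=> mf f0; rewrite lt_def integral_ge0 ?andbT; last first.
  by move=> w _; rewrite lee_fin ltW.
apply/eqP => If0.
have mEf : measurable_fun setT (EFin \o f) by exact/measurable_EFinP.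
have [+ _] := ae_eq_integral_abs S measurableT mEf.
case.
  by rewrite -[RHS]If0; apply: eq_integral => w _ /=; rewrite gtr0_norm.
move=> N [mN SN0 sub].
have : S setT = 0%E.
  rewrite (_ : setT = N)//; apply/seteqP; split => // w _; apply: sub => /= /(_ I) [].
  by apply/eqP; rewrite gt_eqF.
by rewrite probability_setT => /eqP; rewrite onee_eq0.
Qed.

Lemma mgfE dd (U : measurableType dd) (S : probability U R) (X : {RV S >-> R}) h :
  ('M_S X h = \int[S]_w (expR (h * X w))%:E)%E.
Proof.
rewrite /mmt_gen_fun unlock; apply: eq_integral => w _ /=; congr (expR _)%:E.
exact: mulrC.
Qed.

Lemma measurable_expRM dd (U : measurableType dd) (S : probability U R) (X : {RV S >-> R}) h :
  measurable_fun setT (fun w => expR (h * X w)).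
Proof.
by apply: measurableT_comp => //; exact: measurable_funM.
Qed.

Lemma mgf_gt0 dd (U : measurableType dd) (S : probability U R) (X : {RV S >-> R}) h :
  (0 < 'M_S X h)%E.
Proof.
by rewrite mgfE integral_gt0//; [exact: measurable_expRM|move=> w; exact: expR_gt0].
Qed.

Variables (X : {RV P >-> R}) (theta : R) (Y : {RV Q >-> R}).
Hypotheses (iX : int_valued X) (tY : exp_tilt X theta Y).

(** Only the laws of [X] and [Y] are related, not the variables, which live on
    different spaces; the comparison is made atom by atom. *)
Lemma exp_tilt_integral (g : R -> R) : (forall y, 0 <= g y) ->
  (\int[Q]_w (g (Y w))%:E =
   \int[P]_w (g (X w) * (expR (theta * X w) / fine ('M_P X theta)))%:E)%E.
Proof.
move=> g0; have [iY pY] := tY.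
have M0 : 0 <= fine ('M_P X theta) by rewrite fine_ge0// expectation_ge0// => w; exact: expR_ge0.
under eq_integral do rewrite -(int_valued_floor _ iY).
under [RHS]eq_integral do rewrite -(int_valued_floor _ iX).
apply: (@eq_integral_discrete _ _ _ _ _ _ _ _ _ _ (fun k : int => (g k%:~R)%:E)
  (fun k : int => (g k%:~R * (expR (theta * k%:~R) / fine ('M_P X theta)))%:E)).
- by move=> k; rewrite floor_fiber//; exact: measurable_funPTI.
- by move=> k; rewrite floor_fiber//; exact: measurable_funPTI.
- by move=> k; rewrite lee_fin.
- by move=> k; rewrite lee_fin mulr_ge0// divr_ge0// expR_ge0.
- move=> k; rewrite !floor_fiber// !pmfE pY -!EFinM; congr EFin; ring.
Qed.

(** An infinite moment generating function has [fine] equal to [0], which would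
    make all the weights of [Y] vanish. *)
Lemma exp_tilt_mgf_fin : ('M_P X theta < +oo)%E.
Proof.
rewrite ltey; apply/eqP => MX.
have := exp_tilt_integral (fun=> ler01).
under [X in _ = X -> _]eq_integral do rewrite MX /= invr0 !mulr0.
rewrite integral0 integral_cst//= probability_setT mule1 => /eqP.
by rewrite onee_eq0.
Qed.

Lemma exp_tilt_mgf_gt0 : 0 < fine ('M_P X theta).
Proof. by rewrite fine_gt0// mgf_gt0 exp_tilt_mgf_fin. Qed.

Lemma exp_tilt_mgf h :
  ('M_Q Y h = 'M_P X (theta + h)%R * ((fine ('M_P X theta))^-1)%:E)%E.
Proof.
have M0 := exp_tilt_mgf_gt0.
rewrite (mgfE Y) (mgfE X (_ + _)) (@exp_tilt_integral (fun y => expR (h * y))); last first.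
  by move=> y; exact: expR_ge0.
rewrite -ge0_integralZr//.
- apply: eq_integral => w _; rewrite -EFinM mulrDl expRD; congr EFin; ring.
- by apply/measurable_EFinP; exact: measurable_expRM.
- by rewrite lee_fin invr_ge0 ltW.
Qed.

End tilting.

Section tilt_sum.
Context d (T : measurableType d) d' (T' : measurableType d') (R : realType)
  (P : probability T R) (Q : probability T' R).
Variables (I : finType) (X : I -> {RV P >-> R}) (theta : R) (Y : I -> {RV Q >-> R}).
Hypotheses (iX : forall i, int_valued (X i)).
Hypotheses (indepX : mutually_independent X) (indepY : mutually_independent Y).
Hypothesis tY : forall i, exp_tilt (X i) theta (Y i).

Lemma sum_RVE dd (U : measurableType dd) (S : probability U R) (J : Type) (s : seq J)
  (Z : J -> {RV S >-> R}) w : (\sum_(j <- s) Z j : {RV S >-> R}) w = \sum_(j <- s) Z j w.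
Proof. by elim/big_rec2 : _ => // j y1 y2 _ <-. Qed.

Lemma joint_floor_fiber dd (U : measurableType dd) (S : probability U R)
    (Z : I -> {RV S >-> R}) (k : {ffun I -> int}) : (forall i, int_valued (Z i)) ->
  (fun w => [ffun i => Num.floor (Z i w)]) @^-1` [set k] =
  \bigcap_(i in [set` [set: I]%SET]) (Z i @^-1` [set (k i)%:~R]).
Proof.
move=> iZ; apply/seteqP; split => w /=.
  by move=> <- i _ /=; rewrite ffunE int_valued_floor.
move=> kw; apply/ffunP => i; rewrite ffunE; have -> : Z i w = (k i)%:~R.
  by apply: kw; rewrite /= finset.inE.
by rewrite intrKfloor.
Qed.

Lemma joint_pmf dd (U : measurableType dd) (S : probability U R)
    (Z : I -> {RV S >-> R}) (k : {ffun I -> int}) : (forall i, int_valued (Z i)) ->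
  mutually_independent Z ->
  S ((fun w => [ffun i => Num.floor (Z i w)]) @^-1` [set k]) =
  (\prod_i pmf (Z i) (k i)%:~R)%:E.
Proof.
move=> iZ indepZ; rewrite joint_floor_fiber// indepZ// -prodEFin.
by apply: eq_big => i; rewrite ?finset.inE// pmfE.
Qed.

(** By independence both joint laws are products on the countable set of integer
    vectors, and the tilting factors multiply to the exponential of the sum. *)
Lemma tilt_sum_integral (g : R -> R) : (forall y, 0 <= g y) ->
  (\int[Q]_w (g (\sum_i Y i w))%:E =
   \int[P]_w (g (\sum_i X i w) * (expR (theta * \sum_i X i w) /
     \prod_i fine ('M_P (X i) theta)))%:E)%E.
Proof.
move=> g0; have iY i : int_valued (Y i) by case: (tY i).
have M0 i : 0 < fine ('M_P (X i) theta) by exact: exp_tilt_mgf_gt0 (iX i) (tY i).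
pose V w := [ffun i => Num.floor (X i w)]; pose W w := [ffun i => Num.floor (Y i w)].
have VE w : \sum_i X i w = \sum_i (V w i)%:~R.
  by apply: eq_bigr => i _; rewrite ffunE int_valued_floor.
have WE w : \sum_i Y i w = \sum_i (W w i)%:~R.
  by apply: eq_bigr => i _; rewrite ffunE int_valued_floor.
under eq_integral do rewrite WE.
under [RHS]eq_integral do rewrite VE.
have mfiber dd (U : measurableType dd) (S : probability U R) (Z : I -> {RV S >-> R})
    (k : {ffun I -> int}) : (forall i, int_valued (Z i)) ->
    measurable ((fun w => [ffun i => Num.floor (Z i w)]) @^-1` [set k]).
  move=> iZ; rewrite joint_floor_fiber//.
  apply: fin_bigcap_measurable; first exact: finite_finset.
  by move=> i _; exact: measurable_funPTI.
apply: (@eq_integral_discrete _ _ _ _ _ _ _ _ _ _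
  (fun k : {ffun I -> int} => (g (\sum_i (k i)%:~R))%:E)
  (fun k : {ffun I -> int} => (g (\sum_i (k i)%:~R) * (expR (theta * \sum_i (k i)%:~R) /
     \prod_i fine ('M_P (X i) theta)))%:E)).
- by move=> k; exact: mfiber.
- by move=> k; exact: mfiber.
- by move=> k; rewrite lee_fin.
- move=> k; rewrite lee_fin mulr_ge0// divr_ge0 ?expR_ge0//.
  by apply: prodr_ge0 => i _; exact: ltW.
- move=> k; rewrite !joint_pmf// -!EFinM; congr EFin; rewrite -mulrA; congr (_ * _).
  under eq_bigr do rewrite (tY _).2.
  by rewrite mulr_sumr expR_sum -prodf_div mulrC -big_split/=; apply: eq_bigr => i _; ring.
Qed.

Lemma exp_tilt_sum : exp_tilt (\sum_i X i : {RV P >-> R}) theta (\sum_i Y i : {RV Q >-> R}).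
Proof.
have iY i : int_valued (Y i) by case: (tY i).
set SX := (\sum_i X i : {RV P >-> R}); set SY := (\sum_i Y i : {RV Q >-> R}).
have SXE w : SX w = \sum_i X i w by exact: sum_RVE.
have SYE w : SY w = \sum_i Y i w by exact: sum_RVE.
pose M := \prod_i fine ('M_P (X i) theta).
have M0 : 0 < M by apply: prodr_gt0 => i _; exact: exp_tilt_mgf_gt0 (iX i) (tY i).
have cE (c : R) (f : T -> R) : measurable_fun setT f -> (forall w, 0 <= f w) -> 0 <= c ->
    (\int[P]_w (f w * c)%:E = \int[P]_w (f w)%:E * c%:E)%E.
  move=> mf f0 c0; under eq_integral do rewrite EFinM.
  by rewrite ge0_integralZr//; [exact/measurable_EFinP|move=> w _; rewrite lee_fin].
(* the weights of the tilted sum have total mass [1], which identifies [M] *)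
have ME : fine ('M_P SX theta) = M.
  have := @tilt_sum_integral (fun=> 1) (fun=> ler01).
  rewrite integral_cst//= probability_setT mule1 -/M.
  under eq_integral do rewrite mul1r -SXE.
  rewrite cE; last 3 first.
  - exact: measurable_expRM.
  - by move=> w; exact: expR_ge0.
  - by rewrite invr_ge0 ltW.
  rewrite -mgfE; case: ('M_P SX theta)%E (mgf_gt0 SX theta) => [r r0|_|//] /=.
    by rewrite -EFinM => -[] /esym /divr1_eq.
  by rewrite gt0_mulye// lte_fin invr_gt0.
split; first by move=> w; rewrite SYE; apply: rpred_sum => i _; exact: iY.
move=> s; apply: EFin_inj; rewrite ME -pmfE.
have mS dd (U : measurableType dd) (S : probability U R) (Z : {RV S >-> R}) :
    S (Z @^-1` [set s%:~R]) = (\int[S]_w (\1_[set s%:~R : R] (Z w))%:E)%E.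
  rewrite -[RHS]/(\int[S]_w (\1_(Z @^-1` [set s%:~R]) w)%:E)%E.
  by rewrite integral_indic ?setIT//; exact: measurable_funPTI.
rewrite mS; under eq_integral do rewrite SYE.
rewrite (@tilt_sum_integral (\1_[set s%:~R])) -/M; last by move=> y; rewrite indicE.
transitivity (\int[P]_w (\1_[set s%:~R : R] (SX w) * (expR (theta * s%:~R) / M))%:E)%E.
  apply: eq_integral => w _; rewrite -SXE; congr EFin.
  have [->//|/eqP ws] := eqVneq (SX w) s%:~R.
  by rewrite indicE memNset// !mul0r.
rewrite cE.
- by rewrite -mS pmfE -EFinM; congr EFin; ring.
- by apply: measurableT_comp => //; exact: measurable_indic.
- by move=> w; rewrite indicE.
- by rewrite divr_ge0 ?expR_ge0// ltW.
Qed.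

End tilt_sum.

(** * Tangent lines and exponential moments *)

(** The graph lies above a line through the point at [x], so that the difference
    quotients are at least [m] on the right and at most [m] on the left; nothing
    is known about derivatives at other points. *)
Lemma is_derive_support_line (R : realType) (f : R -> R) (x df m r : R) :
  0 < r -> is_derive x 1 f df ->
  (forall h, `|h| < r -> h * m <= f (x + h) - f x) -> df = m.
Proof.
move=> r0 [dfx dfE] fm.
have : (fun h => h^-1 *: (f (h *: 1 + x) - f x)) @ 0^' --> df.
  by rewrite -dfE.
move/cvgrPdist_le => cvgq.
suff H (e : R) : 0 < e -> `|df - m| <= e.
  apply/eqP; rewrite -subr_eq0 -normr_le0 leNgt; apply/negP => dm.
  by have := H (`|df - m| / 2); rewrite divr_gt0// => /(_ isT); lra.
move=> e0; have /nbhs_ballP[del /= del0 Hdel] := cvgq e e0.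
pose h := Num.min del r / 2.
have md : 0 < Num.min del r by rewrite lt_min del0.
have h0 : 0 < h by rewrite divr_gt0.
have hr : h < r by have : Num.min del r <= r; [rewrite ge_min lexx orbT|rewrite /h; lra].
have hd : h < del by have : Num.min del r <= del; [rewrite ge_min lexx|rewrite /h; lra].
have := Hdel h; have := Hdel (- h).
rewrite /ball /= !sub0r !normrN (gtr0_norm h0) => /(_ hd) + /(_ hd).
rewrite oppr_eq0 gt_eqF// => /(_ isT) + /(_ isT).
rewrite /GRing.scale /= !mulr1 ![_ + x]addrC.
have := fm h; have := fm (- h); rewrite normrN (gtr0_norm h0) => /(_ hr) h1 /(_ hr) h2.
set A := f (x + h) - f x in h2 *; set B := f (x - h) - f x in h1 *.
have : m <= h^-1 * A by rewrite mulrC ler_pdivlMr// mulrC.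
have : (- h)^-1 * B <= m by rewrite invrN mulNr lerNl mulrC ler_pdivlMr//; lra.
by rewrite !ler_norml; lra.
Qed.

Section moments.
Context d (T : measurableType d) (R : realType) (P : probability T R).
Implicit Types (Y : {RV P >-> R}).

(** Every power is at most a constant times [expR (r * Y) + expR (- r * Y)]. *)
Lemma mgf_integrable_pow Y (r m : R) n : 0 < r ->
  ('M_P Y r < +oo)%E -> ('M_P Y (- r) < +oo)%E ->
  P.-integrable setT (EFin \o (fun w => `|Y w - m| ^+ n)).
Proof.
move=> r0 M1 M2.
have ie h : ('M_P Y h < +oo)%E -> P.-integrable setT (EFin \o (fun w => expR (h * Y w))).
  move=> Mh; apply/integrableP; split; first exact/measurable_EFinP/measurable_expRM.
  rewrite mgfE in Mh; under eq_integral do rewrite /= ger0_norm ?expR_ge0//.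
  exact: Mh.
pose c := (n`!%:R / r ^+ n) * expR (r * `|m|).
have := integrableZl measurableT c (integrableD measurableT (ie _ M1) (ie _ M2)).
apply: le_integrable => //.
  apply/measurable_EFinP; apply: measurable_funX; apply: measurableT_comp => //.
  exact: measurable_funB.
move=> w _ /=; rewrite lee_fin.
have c0 : 0 <= c by rewrite mulr_ge0 ?expR_ge0// divr_ge0 ?exprn_ge0 ?ltW.
rewrite normrX normr_id [leRHS]ger0_norm; last first.
  by rewrite mulr_ge0// addr_ge0// expR_ge0.
have rn0 : 0 < r ^+ n by exact: exprn_gt0.
rewrite [leRHS](_ : _ = n`!%:R * (expR (r * `|m|) *
    (expR (r * Y w) + expR (- r * Y w))) / r ^+ n); last by rewrite /c; ring.
rewrite ler_pdivlMr// -exprMn.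
have f0 : 0 < n`!%:R :> R by rewrite ltr0n fact_gt0.
rewrite [leRHS]mulrC -ler_pdivrMr//.
apply: (@le_trans _ _ (expR (`|Y w - m| * r))).
  have : 0 <= `|Y w - m| * r by rewrite mulr_ge0// ltW.
  case: n {c c0 rn0} f0 => [|n] f0 x0; first by rewrite expr0 fact0 divr1 -expR0 ler_expR.
  by apply: le_trans (expR_ge1Dxn n x0); rewrite lerDr.
apply: (@le_trans _ _ (expR (r * `|m|) * expR (r * `|Y w|))).
  by rewrite -expRD ler_expR -mulrDr [leLHS]mulrC ler_pM2l// [leRHS]addrC ler_normB.
rewrite ler_pM2l ?expR_gt0//.
have e1 := expR_ge0 (r * Y w); have e2 := expR_ge0 (- r * Y w).
case: (ger0P (Y w)) => _; first by lra.
by rewrite mulrN -mulNr; lra.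
Qed.

End moments.

(** * The characteristic function of a centred variable *)

Section centered.
Context d (T : measurableType d) (R : realType) (P : probability T R).
Local Open Scope complex_scope.
Implicit Types Z : T -> R.

Lemma cbounded_mfun_expi Z l : measurable_fun setT Z ->
  cbounded_mfun (fun w => expi (l * Z w)).
Proof.
move=> mZ; have mlZ : measurable_fun setT (fun w => l * Z w) by exact: measurable_funM.
split; split => /=.
- apply: (measurableT_comp _ mlZ); exact: continuous_measurable_fun (@continuous_cos R).
- by exists 1 => w; exact: cos_max.
- apply: (measurableT_comp _ mlZ); exact: continuous_measurable_fun (@continuous_sin R).
- by exists 1 => w; exact: sin_max.
Qed.

Lemma normc_le_ReIm (z : R[i]) : normc z <= `|complex.Re z| + `|complex.Im z|.
Proof.
case: z => a b /=; rewrite -(ler_pXn2r (ltn0Sn 1)) ?nnegrE ?sqrtr_ge0 ?addr_ge0//.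
rewrite sqr_sqrtr ?addr_ge0 ?sqr_ge0// sqrrD !real_normK ?num_real//.
by have := mulr_ge0 (normr_ge0 a) (normr_ge0 b); lra.
Qed.

(** The real and imaginary parts are integrated separately, so the triangle
    inequality for integrals does not apply directly; instead, a variance is
    nonnegative. *)
Lemma normc_charfun_le1 Z l : measurable_fun setT Z ->
  normc (cexpectation P (fun w => expi (l * Z w))) <= 1.
Proof.
move=> mZ; have [bc bs] := cbounded_mfun_expi l mZ.
rewrite cexpectationE /=; set p := (\int[P]_w _)%R; set q := (\int[P]_w _)%R.
rewrite -[leRHS]sqrtr1; apply: ler_wsqrtr.
(* the mean square distance of [expi (l * Z)] to the constant [p +i* q] *)
have : 0 <= \int[P]_w ((1 + p ^+ 2 + q ^+ 2) -
    (2 * p * cos (l * Z w) + 2 * q * sin (l * Z w))).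
  apply: Rintegral_ge0 => w _.
  have := cos2Dsin2 (l * Z w); set x := cos _; set y := sin _.
  have := sqr_ge0 (p - x); have := sqr_ge0 (q - y); lra.
have bcst r := bounded_mfun_cst T (r : R).
have i1 := bounded_mfun_integrable P (bounded_mfunM (bcst (2 * p)) bc).
have i2 := bounded_mfun_integrable P (bounded_mfunM (bcst (2 * q)) bs).
have i3 := bounded_mfun_integrable P
  (bounded_mfunD (bounded_mfunM (bcst (2 * p)) bc) (bounded_mfunM (bcst (2 * q)) bs)).
rewrite RintegralB//; last exact: bounded_mfun_integrable.
have -> : \int[P]_w (2 * p * cos (l * Z w) + 2 * q * sin (l * Z w)) = 2 * p * p + 2 * q * q.
  by rewrite RintegralD// !RintegralZl//; exact: bounded_mfun_integrable.
rewrite Rintegral_prob_cst; lra.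
Qed.

Variable Z : T -> R.
Hypothesis mZ : measurable_fun setT Z.
Hypothesis iZ : forall n, P.-integrable setT (EFin \o (fun w => `|Z w| ^+ n)).

Let iZ1 : P.-integrable setT (EFin \o Z).
Proof.
apply: le_integrable (iZ 1) => //; first exact/measurable_EFinP.
by move=> w _ /=; rewrite lee_fin expr1 normr_id.
Qed.

Let iZ2 : P.-integrable setT (EFin \o (fun w => Z w ^+ 2)).
Proof.
have := iZ 2; apply: eq_integrable => // w _ /=.
by rewrite real_normK// num_real.
Qed.

(** An instance of Lyapunov's inequality, obtained by integrating a tangent
    inequality at the standard deviation [s]. *)
Lemma lyapunov_23 :
  Num.sqrt (\int[P]_w (Z w ^+ 2)) ^+ 3 <= \int[P]_w (`|Z w| ^+ 3).
Proof.
set s2 := (\int[P]_w _)%R; set eta := (\int[P]_w _)%R.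
have s20 : 0 <= s2 by apply: Rintegral_ge0 => w _; exact: sqr_ge0.
have eta0 : 0 <= eta by apply: Rintegral_ge0 => w _; exact: exprn_ge0.
set s := Num.sqrt s2; have sE : s ^+ 2 = s2 by exact: sqr_sqrtr.
have [s0|s0] := leP s 0.
  have -> : s = 0 by apply/eqP; rewrite eq_le s0 sqrtr_ge0.
  by rewrite expr0n.
(* the integral of [3 s |Z| ^ 2 <= 2 |Z| ^ 3 + s ^ 3] *)
have : (3 * s) * s2 <= 2 * eta + s ^+ 3.
  rewrite /s2 /eta -RintegralZl// -RintegralZl// -[X in _ <= _ + X](Rintegral_prob_cst P).
  have i1 := integrableZl measurableT (3 * s) iZ2.
  have i2 := integrableZl measurableT 2 (iZ 3).
  have i3 : P.-integrable setT (EFin \o (fun _ : T => s ^+ 3)).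
    exact: (bounded_mfun_integrable P (bounded_mfun_cst T _)).
  rewrite -RintegralD//; apply: le_Rintegral => //.
    by have := integrableD measurableT i2 i3.
  move=> w _; rewrite -(real_normK (num_real (Z w))).
  have := normr_ge0 (Z w); move: `|Z w| => x x0.
  rewrite -subr_ge0 (_ : _ - _ = (x - s) ^+ 2 * (2 * x + s)); last by ring.
  by rewrite mulr_ge0 ?sqr_ge0//; lra.
by rewrite -sE; nra.
Qed.

Hypothesis Z0 : \int[P]_w Z w = 0.

(** Each of the real and imaginary parts contributes a sixth of the third moment
    to the error; the sum is bounded generously. *)
Lemma normc_charfun_taylor l : 0 <= l ->
  normc (cexpectation P (fun w => expi (l * Z w)) -
    (1 - (l * Num.sqrt (\int[P]_w (Z w ^+ 2))) ^+ 2 / 2)%:C) <=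
  l ^+ 3 * \int[P]_w (`|Z w| ^+ 3).
Proof.
move=> l0; have [bc bs] := cbounded_mfun_expi l mZ.
have ic := bounded_mfun_integrable P bc.
have isn := bounded_mfun_integrable P bs.
have s20 : 0 <= \int[P]_w (Z w ^+ 2) by apply: Rintegral_ge0 => w _; exact: sqr_ge0.
rewrite exprMn sqr_sqrtr// cexpectationE.
set eta := \int[P]_w (`|Z w| ^+ 3).
have i1 := integrableZl measurableT (l ^+ 2 / 2) iZ2.
have i3 := integrableZl measurableT (l ^+ 3 / 6) (iZ 3).
have icst : P.-integrable setT (EFin \o (fun _ : T => 1 : R)).
  exact: (bounded_mfun_integrable P (bounded_mfun_cst T _)).
have norm3 w : `|l * Z w| ^+ 3 / 6 = l ^+ 3 / 6 * `|Z w| ^+ 3.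
  by rewrite normrM (ger0_norm l0); ring.
have bound (f : T -> R) : P.-integrable setT (EFin \o f) ->
    (forall w, `|f w| <= `|l * Z w| ^+ 3 / 6) -> `|\int[P]_w f w| <= l ^+ 3 / 6 * eta.
  move=> jf fle; apply: (le_trans (le_normr_Rintegral measurableT jf)).
  rewrite /eta -RintegralZl//; apply: le_Rintegral => //.
  - by have := integrable_norm jf.
  - by move=> w _; rewrite -norm3.
have ie := bounded_mfun_integrable P bc.
have i4 : P.-integrable setT (EFin \o (fun w => 1 - l ^+ 2 / 2 * Z w ^+ 2)).
  by have := integrableB measurableT icst i1.
have i5 : P.-integrable setT (EFin \o (fun w => l * Z w)).
  by have := integrableZl measurableT l iZ1.
have re : `|\int[P]_w cos (l * Z w) - (1 - l ^+ 2 * \int[P]_w (Z w ^+ 2) / 2)| <= l ^+ 3 / 6 * eta.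
  have -> : 1 - l ^+ 2 * \int[P]_w (Z w ^+ 2) / 2 = \int[P]_w (1 - l ^+ 2 / 2 * Z w ^+ 2).
    by rewrite RintegralB// RintegralZl// Rintegral_prob_cst; ring.
  rewrite -RintegralB//; apply: bound.
    by have := integrableB measurableT ic i4.
  move=> w; have := normr_cos_taylor (l * Z w).
  by rewrite (_ : (l * Z w) ^+ 2 / 2 = l ^+ 2 / 2 * Z w ^+ 2)//; ring.
have im : `|\int[P]_w sin (l * Z w)| <= l ^+ 3 / 6 * eta.
  have -> : \int[P]_w sin (l * Z w) = \int[P]_w (sin (l * Z w) - l * Z w).
    by rewrite RintegralB// RintegralZl// Z0 mulr0 subr0.
  apply: bound; first by have := integrableB measurableT isn i5.
  by move=> w; exact: normr_sin_taylor.
have e0 : 0 <= l ^+ 3 * eta.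
  by rewrite mulr_ge0 ?exprn_ge0//; apply: Rintegral_ge0 => w _; exact: exprn_ge0.
apply: (le_trans (normc_le_ReIm _)) => /=; rewrite ?subr0 ?oppr0 ?addr0.
by move: re im; lra.
Qed.

End centered.

(** The pointwise inequality [z ^ 2 <= 2 |z| ^ 3] fails for small [z].  With [p]
    the fractional part of [m], it holds at all [z] in the integers minus [m]
    once the multiple [2 * beta * z] of the mean-zero variable is subtracted on
    the right, where [beta = p / 2 - p ^ 2] is chosen to give equality at
    [z = - p]. *)
Lemma int_variance_le_abs3 d (T : measurableType d) (R : realType)
    (P : probability T R) (Y : T -> R) (m : R) :
  int_valued Y -> measurable_fun setT Y ->
  (forall n, P.-integrable setT (EFin \o (fun w => `|Y w - m| ^+ n))) ->
  \int[P]_w (Y w - m) = 0 ->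
  \int[P]_w ((Y w - m) ^+ 2) <= 2 * \int[P]_w (`|Y w - m| ^+ 3).
Proof.
move=> iY mY iZ Z0.
have mZ : measurable_fun setT (fun w => Y w - m) by exact: measurable_funB.
pose f : R := (Num.floor m)%:~R.
have fm : f <= m by rewrite /f floor_le_tmp.
have mf : m < f + 1 by have := floorD1_gt m; rewrite intrD.
pose p := m - f; pose beta := p / 2 - p ^+ 2.
have pw (y : R) : y \is a Num.int -> (y - m) ^+ 2 <= 2 * `|y - m| ^+ 3 - 2 * beta * (y - m).
  move=> /intrP[k ->]; pose j := (k - Num.floor m)%R.
  have jE : k%:~R - m = j%:~R - p by rewrite /j /p /f rmorphB /=; ring.
  rewrite jE; have p0 : 0 <= p by rewrite /p; lra.
  have p1 : p < 1 by rewrite /p; lra.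
  have [j0|j1] := leP j 0.
    have x0 : j%:~R <= 0 :> R by rewrite lerz0.
    rewrite ler0_norm; last by lra.
    rewrite -subr_ge0 (_ : _ - _ = 2 * (p - j%:~R) * (- j%:~R * (2 * p - j%:~R - 1 / 2)));
      last by rewrite /beta; field.
    apply: mulr_ge0; first by lra.
    have [->|jN] := eqVneq j 0; first by rewrite oppr0 mul0r.
    have : j%:~R <= - 1 :> R by rewrite -[-1]/((-1)%:~R) ler_int; lia.
    by move=> xN1; apply: mulr_ge0; lra.
  have x1 : 1 <= j%:~R :> R by rewrite -[1]/(1%:~R) ler_int; lia.
  rewrite ger0_norm; last by lra.
  rewrite -subr_ge0 (_ : _ - _ = 2 * (j%:~R - p) *
    ((j%:~R - 1) * (j%:~R - 2 * p + 1 / 2) + 2 * (p - 1 / 2) ^+ 2)); last by rewrite /beta; field.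
  apply: mulr_ge0; first by lra.
  apply: addr_ge0; last by rewrite mulr_ge0 ?sqr_ge0.
  have [->|jN] := eqVneq j 1; first by rewrite subrr mul0r.
  have : 2 <= j%:~R :> R by rewrite -[2]/(2%:~R) ler_int; lia.
  by move=> x2; apply: mulr_ge0; lra.
have iZ1 : P.-integrable setT (EFin \o (fun w => Y w - m)).
  apply: le_integrable (iZ 1) => //; first exact/measurable_EFinP.
  by move=> w _ /=; rewrite lee_fin expr1 normr_id.
have iZ2 : P.-integrable setT (EFin \o (fun w => (Y w - m) ^+ 2)).
  by have := iZ 2; apply: eq_integrable => // w _ /=; rewrite real_normK// num_real.
have i3 := integrableZl measurableT 2 (iZ 3).
have i1 := integrableZl measurableT (2 * beta) iZ1.
rewrite -[leRHS](subr0) -[in leRHS](mulr0 (2 * beta)) -Z0 -RintegralZl// -RintegralZl//.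
rewrite -RintegralB//; apply: le_Rintegral => //.
  by have := integrableB measurableT i3 i1.
by move=> w _; exact: pw.
Qed.

(** * Fourier inversion on the integers *)

Section inversion.
Variable R : realType.
Local Notation mu := (@lebesgue_measure R).

Lemma sin_intpi (n : int) : sin (n%:~R * pi) = 0 :> R.
Proof.
have nat_case (m : nat) : sin (m%:R * pi) = 0 :> R.
  elim: m => [|m IH]; first by rewrite mul0r sin0.
  by rewrite -natr1 mulrDl mul1r sinD IH sinpi mul0r mulr0 addr0.
by case: n => m; rewrite ?NegzE ?rmorphN /= ?mulNr ?sinN ?nat_case ?oppr0.
Qed.

Lemma integral_1Dcos_int (n : int) :
  (\int[mu]_(x in `[(- pi)%R, pi%R]) (1 + cos (x * n%:~R))%:E =
   (2 * pi * (1 + (n == 0)%:R))%:E)%E.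
Proof.
have pi0 := pi_gt0 R.
have [->|n0] := eqVneq n 0.
  under eq_integral do rewrite mulr0 cos0.
  rewrite integral_cst//= lebesgue_measure_itv/= lte_fin ifT; last by lra.
  by rewrite -EFinD -EFinM; congr EFin; ring.
have nr : n%:~R != 0 :> R by rewrite intr_eq0.
pose F : R -> R := id + n%:~R^-1 *: (@sin R \o ( *%R^~ n%:~R)).
have dF (x : R) : is_derive x 1 F (1 + cos (x * n%:~R)).
  have dm : is_derive x 1 ( *%R^~ (n%:~R : R)) (n%:~R : R).
    rewrite (_ : *%R^~ (n%:~R : R) = n%:~R *: (id : R -> R)); last first.
      by apply/funext => y; rewrite fctE /GRing.scale /= mulrC.
    by apply: is_derive_eq; rewrite /GRing.scale /= mulr1.
  have ds := @is_derive1_comp _ (@sin R) ( *%R^~ n%:~R) x _ _ (is_derive_sin _) dm.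
  have dF := is_deriveD (is_derive_id x 1) (is_deriveZ n%:~R^-1 ds).
  apply: DeriveDef; first exact: (@ex_derive _ _ _ _ _ _ _ dF).
  rewrite (@derive_val _ _ _ _ _ _ _ dF) /GRing.scale /=.
  by rewrite [cos _ * _]mulrC mulKf.
have eF (z : R) : derivable F z 1 by exact: (@ex_derive _ _ _ _ _ _ _ (dF z)).
have cF (z : R) : {for z, continuous F}.
  by apply: differentiable_continuous; apply/derivable1_diffP.
rewrite (_ : (fun x => (1 + cos (x * n%:~R))%:E) =
    (fun x => ((fun y : R => 1 + cos (y * n%:~R)) x)%:E))//.
rewrite (continuous_FTC2 (F := F)); last 4 first.
- by lra.
- apply: continuous_subspaceT => x; apply: cvgD; first exact: cvg_cst.
  apply: (cvg_comp ( *%R^~ n%:~R) (@cos R)); last exact: continuous_cos.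
  by apply: cvgM; [exact: cvg_id|exact: cvg_cst].
- split.
  + by move=> x _; exact: eF.
  + by apply: cvg_at_right_filter; exact: cF.
  + by apply: cvg_at_left_filter; exact: cF.
- by move=> x _; rewrite derive1E; exact: (@derive_val _ _ _ _ _ _ _ (dF x)).
rewrite -EFinB; congr EFin; rewrite /F !fctE /GRing.scale /= mulNr sinN [pi * _]mulrC.
by rewrite sin_intpi oppr0 mulr0; ring.
Qed.

Context d (T : measurableType d) (Q : probability T R).
Variables (Y : {RV Q >-> R}) (t : int).
Hypothesis iY : int_valued Y.

Let phi (l : R) := \int[Q]_w cos (l * (Y w - t%:~R)).

(* the summand [1] makes the integrand nonnegative, as Tonelli's theorem requires *)
Let f (x : R * T) : \bar R :=
  (\1_`[- pi, pi] x.1 * (1 + cos (x.1 * (Y x.2 - t%:~R))))%:E.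

Let f0 x : (0 <= f x)%E.
Proof.
by rewrite lee_fin mulr_ge0// ?indicE//; have := cos_geN1 (x.1 * (Y x.2 - t%:~R)); lra.
Qed.

Let mf : measurable_fun setT f.
Proof.
apply/measurable_EFinP; apply: measurable_funM.
  by apply: (measurableT_comp (f := (\1_`[- pi, pi] : R -> R))) => //; exact: measurable_indic.
apply: measurable_funD => //.
apply: (measurableT_comp (f := @cos R)).
  exact: continuous_measurable_fun (@continuous_cos R).
apply: measurable_funM => //; apply: measurable_funB => //.
by apply: measurableT_comp.
Qed.

Let mYt : measurable_fun setT (fun w => Y w - t%:~R : R).
Proof. exact: measurable_funB. Qed.

Let bcos l : bounded_mfun (fun w => cos (l * (Y w - t%:~R))).
Proof. by have [] := cbounded_mfun_expi l mYt. Qed.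

Let phiE l : (\int[Q]_w f (l, w) = (\1_`[(- pi)%R, pi%R] l * (1 + phi l))%:E)%E.
Proof.
have b1 := bounded_mfunD (bounded_mfun_cst T 1) (bcos l).
have i1 := bounded_mfun_integrable Q b1.
rewrite /f /=; under eq_integral do rewrite EFinM.
have mb1 : measurable_fun setT (EFin \o (fun w => 1 + cos (l * (Y w - t%:~R)))).
  by apply/measurable_EFinP; case: b1.
have b10 w : (0 <= (1 + cos (l * (Y w - t%:~R)))%:E)%E.
  by rewrite lee_fin; have := cos_geN1 (l * (Y w - t%:~R)); lra.
rewrite ge0_integralZl_EFin// EFinM; congr (_ * _)%E.
rewrite -[LHS]fineK; last exact: (integrable_fin_num measurableT i1).
congr EFin; rewrite -[LHS]/(\int[Q]_w (1 + cos (l * (Y w - t%:~R)))).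
rewrite RintegralD// ?Rintegral_prob_cst//; apply: bounded_mfun_integrable => //.
exact: bounded_mfun_cst.
Qed.

Let integral_indic_mul (g : R -> R) :
  (\int[mu]_l (\1_`[(- pi)%R, pi%R] l * g l)%:E = \int[mu]_(l in `[(- pi)%R, pi%R]) (g l)%:E)%E.
Proof.
rewrite [RHS]integral_mkcond; apply: eq_integral => l _.
by rewrite /patch indicE; case: ifP => _; rewrite ?mul1r ?mul0r.
Qed.

Let integrable_phi : mu.-integrable `[- pi, pi] (EFin \o phi).
Proof.
apply: measurable_bounded_integrable => //.
- by rewrite /= lebesgue_measure_itv/=; case: ifP => _; rewrite -?EFinD ltry.
- have := @measurable_fun_fubini_tonelli_F _ _ _ _ _ Q f mf f0.
  rewrite /fubini_F; under eq_fun do rewrite phiE.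
  move=> /measurable_EFinP m1.
  have m2 : measurable_fun `[(- pi)%R, pi%R]
      (fun l => \1_`[(- pi)%R, pi%R] l * (1 + phi l) - 1).
    by apply: measurable_funB => //; exact: measurable_funTS.
  apply: eq_measurable_fun m2 => l lI.
  by rewrite indicE lI mul1r; ring.
- exists 1; split; first exact: num_real.
  move=> x x1 l _ /=; apply: le_trans (ltW x1).
  apply: (le_trans (le_normr_Rintegral measurableT (bounded_mfun_integrable Q (bcos l)))).
  rewrite -[leRHS](Rintegral_prob_cst Q); apply: le_Rintegral => //.
  + by have := integrable_norm (bounded_mfun_integrable Q (bcos l)).
  + exact: (bounded_mfun_integrable Q (bounded_mfun_cst T _)).
  + by move=> w _; exact: cos_max.
Qed.

(** The integral over [[- pi, pi]] of [cos (l * n)] vanishes at all integers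
    [n != 0]; exchange the integrals. *)
Lemma pmf_inversion :
  mu.-integrable `[- pi, pi] (EFin \o phi) /\
  \int[mu]_(l in `[- pi, pi]) phi l = 2 * pi * pmf Y t%:~R.
Proof.
split => //; have pi0 := pi_gt0 R.
have := @fubini_tonelli _ _ _ _ _ mu Q f mf f0.
under eq_integral do rewrite phiE.
rewrite integral_indic_mul.
under [X in _ = X -> _]eq_integral => w _.
  rewrite /f /= integral_indic_mul.
  have -> : Y w - t%:~R = (Num.floor (Y w) - t)%:~R.
    by rewrite rmorphB /= (int_valued_floor _ iY).
  rewrite integral_1Dcos_int (_ : (Num.floor (Y w) - t == 0)%:R =
    \1_(Y @^-1` [set t%:~R]) w); first over.
  rewrite indicE subr_eq0; congr (_%:R); congr nat_of_bool.
  apply/eqP/idP => [ft|]; rewrite inE /=; last by move=> ->; rewrite intrKfloor.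
  by rewrite -ft (int_valued_floor _ iY).
have mYt1 : measurable (Y @^-1` [set t%:~R]) by exact: measurable_funPTI.
under [X in _ = X -> _]eq_integral do rewrite EFinM.
have mi : measurable_fun setT (fun w => (\1_(Y @^-1` [set t%:~R]) w)%:E : \bar R).
  by apply/measurable_EFinP; exact: measurable_indic.
have i0 w : (0 <= (\1_(Y @^-1` [set t%:~R]) w : R)%:E)%E by rewrite lee_fin.
have pi20 : 0 <= 2 * pi :> R by lra.
rewrite ge0_integralZl_EFin//; last first.
  by apply/measurable_EFinP; apply: measurable_funD => //; exact: measurable_indic.
under [X in _ = (_ * X)%E -> _]eq_integral do rewrite EFinD.
rewrite ge0_integralD//.
rewrite integral_cst//= probability_setT mule1 integral_indic//= setIT pmfE.
have icst : mu.-integrable `[(- pi)%R, pi%R] (EFin \o (fun _ : R => 1 : R)).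
  apply: measurable_bounded_integrable => //=; last exact: bounded_cst.
  by rewrite lebesgue_measure_itv/=; case: ifP => _; rewrite -?EFinD ltry.
under eq_integral do rewrite EFinD.
rewrite integralD// integral_cst//= lebesgue_measure_itv/= lte_fin ifT; last by lra.
rewrite mul1e /Rintegral -[X in (_ + X)%E]fineK; last exact: (integrable_fin_num _ integrable_phi).
rewrite -!EFinD -EFinM => -[].
set J := fine _; set p := pmf _ _ => E; rewrite -[LHS]/J; lra.
Qed.

End inversion.

(** * Comparison with the Gaussian integral *)

Section gaussian_comparison.
Variable R : realType.
Local Notation mu := (@lebesgue_measure R).

Lemma gauss_scaled (a : R) : 0 < a ->
  mu.-integrable setT (EFin \o (fun l => expR (- ((a * l) ^+ 2 / 2)))) /\
  \int[mu]_l expR (- ((a * l) ^+ 2 / 2)) = Num.sqrt (2 * pi) / a.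
Proof.
move=> a0; have s0 : a^-1 != 0 :> R by rewrite invr_neq0// gt_eqF.
have pE : normal_peak a^-1 = a / Num.sqrt (2 * pi).
  rewrite /normal_peak -mulr_natr -mulrA sqrtrM ?sqr_ge0// sqrtr_sqr.
  by rewrite ger0_norm ?invr_ge0 ?ltW// invfM invrK [pi * _]mulrC.
have q0 : Num.sqrt (2 * pi) != 0 :> R.
  by rewrite gt_eqF// sqrtr_gt0 mulr_gt0// pi_gt0.
have gE : (fun l => expR (- ((a * l) ^+ 2 / 2))) =
    (fun l => Num.sqrt (2 * pi) / a * normal_pdf 0 a^-1 l).
  apply/funext => l; rewrite normal_pdfE// pE /normal_fun subr0 mulrA.
  rewrite (_ : _ / a * (a / _) = 1) ?mul1r; last by field; rewrite q0 gt_eqF.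
  by congr expR; field; rewrite gt_eqF.
have i1 := integrable_normal_pdf (0 : R) a^-1.
rewrite gE; split; first by have := integrableZl measurableT (Num.sqrt (2 * pi) / a) i1.
by rewrite RintegralZl// /Rintegral integral_normal_pdf mulr1.
Qed.

Lemma cube_le_expR (v : R) : 0 <= v -> v ^+ 3 <= 129 * expR (v ^+ 2 / 8).
Proof.
move=> v0; have x0 : 0 <= v ^+ 2 / 8 by have := sqr_ge0 v; lra.
have := expR_ge1Dxn 1 x0; have e0 := expR_ge0 (v ^+ 2 / 8).
rewrite (_ : 2`!%:R = 2 :> R)// (_ : 1 + _ = 1 + v ^+ 4 / 128); last by field.
have v2 : 0 <= v ^+ 2 by exact: sqr_ge0.
have : v ^+ 3 <= 1 + v ^+ 4.
  have [v1|v1] := leP v 1.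
    have := exprn_ile1 3 v0 v1; have := exprn_ge0 4 v0; lra.
  have : 0 <= v ^+ 3 * (v - 1) by rewrite mulr_ge0 ?exprn_ge0//; lra.
  by rewrite (_ : v ^+ 3 * (v - 1) = v ^+ 4 - v ^+ 3); [lra|ring].
have := exprn_ge0 4 v0; lra.
Qed.

Lemma le_expR_sqr (v : R) : v <= 9 * expR (v ^+ 2 / 8).
Proof.
have := expR_ge1Dx (v ^+ 2 / 8); have := sqr_ge0 (v - 1 / 2); nra.
Qed.

Variables (s eta : R) (phi : R -> R).
Hypotheses (s0 : 0 < s) (eta0 : 0 < eta) (s2_le : s ^+ 2 <= 2 * eta).
Hypothesis iphi : mu.-integrable `[- pi, pi] (EFin \o phi).
Let eps := s ^+ 2 / (4 * eta).
Hypothesis phi_near : forall l, `|l| <= eps ->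
  `|phi l - expR (- ((s * l) ^+ 2 / 2))| <=
  6 * (eta * `|l| ^+ 3) * expR (- ((s * l) ^+ 2 / 2) + eta * `|l| ^+ 3).
Hypothesis phi_far : forall l, eps <= `|l| -> `|l| <= pi ->
  `|phi l| <= expR (- ((s * eps) ^+ 2 / 2) + eta * eps ^+ 3).

Let g l : R := expR (- ((s * l) ^+ 2 / 2)).
Let G l : R := expR (- ((s / 2 * l) ^+ 2 / 2)).

Let eps0 : 0 < eps. Proof. by rewrite divr_gt0 ?exprn_gt0// mulr_gt0. Qed.

Let eps_le : eps <= 1 / 2.
Proof.
have e4 : 0 < 4 * eta by rewrite mulr_gt0.
rewrite /eps ler_pdivrMr//; have := s2_le; move: (s ^+ 2) => x; lra.
Qed.

(* [774 = 6 * 129]; half of the Gaussian decay left by [phi_near] absorbs the cube *)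
Let near_bound l : `|l| <= eps -> `|phi l - g l| <= 774 * (eta / s ^+ 3) * G l.
Proof.
move=> le; apply: (le_trans (phi_near le)).
have -> : (s * l) ^+ 2 = (s * `|l|) ^+ 2.
  by rewrite !exprMn (real_normK (num_real l)).
have -> : G l = expR (- ((s * `|l|) ^+ 2 / 8)).
  by rewrite /G !exprMn (real_normK (num_real l)); congr expR; field.
have := normr_ge0 l; move: `|l| le => x le x0.
pose v := s * x; have v0 : 0 <= v by rewrite mulr_ge0// ltW.
have cubeE : eta * x ^+ 3 = eta / s ^+ 3 * v ^+ 3.
  by rewrite /v; field; rewrite gt_eqF.
have cube_le : eta * x ^+ 3 <= v ^+ 2 / 4.
  have : eta * x <= s ^+ 2 / 4 by move: le; rewrite /eps ler_pdivlMr ?mulr_gt0//; lra.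
  move=> h; rewrite (_ : v ^+ 2 / 4 = s ^+ 2 / 4 * x ^+ 2); last by rewrite /v; field.
  by rewrite (_ : eta * x ^+ 3 = eta * x * x ^+ 2) ?ler_wpM2r ?sqr_ge0//; ring.
have r0 : 0 <= eta / s ^+ 3 by rewrite divr_ge0 ?exprn_ge0 ?ltW.
apply: (@le_trans _ _ (6 * (eta * x ^+ 3) * expR (- (v ^+ 2 / 4)))).
  apply: ler_wpM2l; first by rewrite cubeE; do 2 apply: mulr_ge0 => //; exact: exprn_ge0.
  by rewrite ler_expR -/v; lra.
rewrite (_ : - (v ^+ 2 / 4) = - (v ^+ 2 / 8) + - (v ^+ 2 / 8)); last by field.
rewrite expRD -/v cubeE mulrA; apply: ler_wpM2r; first exact: expR_ge0.
rewrite (_ : 6 * _ * _ = 6 * (eta / s ^+ 3) * (v ^+ 3 * expR (- (v ^+ 2 / 8)))); last by ring.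
rewrite (_ : 774 * _ = 6 * (eta / s ^+ 3) * 129); last by ring.
apply: ler_wpM2l; first by rewrite mulr_ge0.
by rewrite expRN ler_pdivrMr ?expR_gt0// cube_le_expR.
Qed.

(* beyond [eps], [1 <= |l| / eps = 4 * (eta / s ^ 3) * (s * |l|)] *)
Let far_gauss l : eps <= `|l| -> g l <= 774 * (eta / s ^+ 3) * G l.
Proof.
move=> le; rewrite /g.
have -> : (s * l) ^+ 2 = (s * `|l|) ^+ 2.
  by rewrite !exprMn (real_normK (num_real l)).
have -> : G l = expR (- ((s * `|l|) ^+ 2 / 8)).
  by rewrite /G !exprMn (real_normK (num_real l)); congr expR; field.
have := normr_ge0 l; move: `|l| le => x le x0.
pose v := s * x; have v0 : 0 <= v by rewrite mulr_ge0// ltW.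
rewrite -/v; have r0 : 0 <= eta / s ^+ 3 by rewrite divr_ge0 ?exprn_ge0 ?ltW.
have one_le : 1 <= 4 * (eta / s ^+ 3) * v.
  rewrite (_ : 4 * _ * v = x / eps); last first.
    by rewrite /v /eps; field; rewrite !gt_eqF.
  by rewrite ler_pdivlMr// mul1r.
rewrite (_ : - (v ^+ 2 / 2) = - (v ^+ 2 / 8) + (- (v ^+ 2 / 8) - v ^+ 2 / 4)); last by field.
rewrite expRD mulrC; apply: ler_wpM2r; first exact: expR_ge0.
have h1 : expR (- (v ^+ 2 / 8) - v ^+ 2 / 4) <= expR (- (v ^+ 2 / 8)).
  by rewrite ler_expR; have := sqr_ge0 v; lra.
have h2 : v * expR (- (v ^+ 2 / 8)) <= 9.
  by rewrite expRN ler_pdivrMr ?expR_gt0// le_expR_sqr.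
have e0 := expR_ge0 (- (v ^+ 2 / 8)).
have h3 : expR (- (v ^+ 2 / 8)) <= 4 * (eta / s ^+ 3) * (v * expR (- (v ^+ 2 / 8))).
  by rewrite mulrA ler_peMl.
have h4 : 4 * (eta / s ^+ 3) * (v * expR (- (v ^+ 2 / 8))) <= 4 * (eta / s ^+ 3) * 9.
  by rewrite ler_wpM2l// mulr_ge0.
lra.
Qed.

Let far_phi l : eps <= `|l| -> `|l| <= pi -> `|phi l| <= 64 * (eta ^+ 2 / s ^+ 6).
Proof.
move=> le lpi; apply: (le_trans (phi_far le lpi)).
pose y := s ^+ 6 / (64 * eta ^+ 2).
have y0 : 0 < y by rewrite divr_gt0 ?exprn_gt0// mulr_gt0 ?exprn_gt0.
rewrite (_ : - _ + _ = - y); last by rewrite /y /eps; field; rewrite gt_eqF.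
rewrite (_ : 64 * _ = y^-1); last by rewrite /y; field; rewrite !gt_eqF.
rewrite expRN lef_pV2 ?posrE ?expR_gt0//.
by have := expR_ge1Dx y; lra.
Qed.

(** The difference of the integrands is dominated on the whole line by a wider
    Gaussian of height [K1] plus the constant [K2] on [[- pi, pi]].  The Gaussian
    part contributes at most [1548 * eta / s ^ 4], so [3160 = 2 * 1548 + 64]. *)
Lemma gaussian_comparison :
  `|\int[mu]_(l in `[- pi, pi]) phi l / (2 * pi) - 1 / (Num.sqrt (2 * pi) * s)| <=
  3160 * (eta ^+ 2 / s ^+ 6).
Proof.
have pi0 := pi_gt0 R; have pi2 : 2 <= pi :> R by have := @pi_ge2 R.
have mI : measurable (`[- pi, pi] : set R) by [].
have [ig gE] := gauss_scaled s0.
have s20 : 0 < s / 2 by rewrite divr_gt0.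
have [iG GE] := gauss_scaled s20.
pose K1 := 774 * (eta / s ^+ 3); pose K2 := 64 * (eta ^+ 2 / s ^+ 6).
have K10 : 0 <= K1 by apply: mulr_ge0; [exact: ler0n|rewrite divr_ge0 ?exprn_ge0 ?ltW].
have K20 : 0 <= K2 by apply: mulr_ge0; [exact: ler0n|rewrite divr_ge0 ?exprn_ge0 ?ltW].
pose I := `[- pi, pi]%classic : set R.
have iP : mu.-integrable setT (EFin \o (phi \_ I)).
  have /integrable_mkcond := iphi; rewrite restrict_EFin; exact.
have i1 : mu.-integrable setT (EFin \o (\1_I : R -> R)).
  exact: integrable_indic_itv.
have I1 : \int[mu]_l \1_I l = 2 * pi.
  rewrite /Rintegral integral_indic// setIT /= lebesgue_measure_itv/= lte_fin.
  by rewrite ifT; [rewrite -EFinD /=; ring|lra].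
have iK1 := integrableZl measurableT K1 iG.
have iK2 := integrableZl measurableT K2 i1.
have dom l : `|(phi \_ I) l - g l| <= K1 * G l + K2 * \1_I l.
  have G0 : 0 <= G l by exact: expR_ge0.
  have g0 : 0 <= g l by exact: expR_ge0.
  have IE : (l \in I) = (`|l| <= pi).
    by rewrite /I mem_setE in_itv /= ler_norml.
  rewrite /patch indicE IE; case: (leP `|l| eps) => [le|le].
    have -> : `|l| <= pi by have := eps_le; lra.
    apply: (le_trans (near_bound le)).
    by rewrite lerDl mulr1.
  have gb := far_gauss (ltW le).
  case: (leP `|l| pi) => [lpi|_].
    have := far_phi (ltW le) lpi; rewrite -/K2 mulr1 => pb.
    by apply: (le_trans (ler_normB _ _)); rewrite (ger0_norm g0) addrC lerD.
  by rewrite sub0r normrN mulr0 addr0 (ger0_norm g0).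
have diffE : `|\int[mu]_(l in `[- pi, pi]) phi l - Num.sqrt (2 * pi) / s| <=
    K1 * (Num.sqrt (2 * pi) / (s / 2)) + K2 * (2 * pi).
  rewrite Rintegral_mkcond -gE -RintegralB//.
  have iB : mu.-integrable setT (EFin \o (fun l => (phi \_ I) l - g l)).
    by have := integrableB measurableT iP ig.
  apply: (le_trans (le_normr_Rintegral measurableT iB)).
  rewrite -GE -I1 -!RintegralZl// -RintegralD//.
  apply: le_Rintegral => //.
  - by have := integrable_norm iB.
  - by have := integrableD measurableT iK1 iK2.
have q0 : 0 < Num.sqrt (2 * pi) :> R by rewrite sqrtr_gt0 mulr_gt0.
have qE : Num.sqrt (2 * pi) ^+ 2 = 2 * pi :> R by rewrite sqr_sqrtr// mulr_ge0// ltW.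
have q1 : 1 <= Num.sqrt (2 * pi) :> R by rewrite -[leLHS]sqrtr1; apply: ler_wsqrtr; lra.
have q_le : Num.sqrt (2 * pi) <= 2 * pi :> R by rewrite -[leRHS]qE expr2 ler_peMl// ltW.
rewrite (_ : _ - _ = (\int[mu]_(l in `[- pi, pi]) phi l - Num.sqrt (2 * pi) / s) / (2 * pi)); last first.
  rewrite mulrBl; congr (_ - _); move: qE q0; set q := Num.sqrt _ => qE q0.
  by rewrite -qE; field; rewrite !gt_eqF.
rewrite normrM normfV (ger0_norm (_ : 0 <= 2 * pi)); last by lra.
rewrite ler_pdivrMr; last by lra.
apply: (le_trans diffE).
pose e2 := eta ^+ 2 / s ^+ 6.
have key : K1 / (s / 2) <= 3096 * e2.
  rewrite (_ : K1 / (s / 2) = 1548 * (s ^+ 2 / eta) * e2); last first.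
    by rewrite /K1 /e2; field; rewrite !gt_eqF.
  have e20 : 0 <= e2 by rewrite /e2 divr_ge0 ?exprn_ge0 ?ltW.
  apply: ler_wpM2r => //.
  have : s ^+ 2 / eta <= 2 by rewrite ler_pdivrMr.
  by lra.
rewrite (_ : K1 * _ = K1 / (s / 2) * Num.sqrt (2 * pi)); last by ring.
have k10 : 0 <= K1 / (s / 2) by rewrite divr_ge0// ltW.
rewrite /K2 -/e2 in key *.
have : K1 / (s / 2) * Num.sqrt (2 * pi) <= 3096 * e2 * (2 * pi).
  by apply: ler_pM => //; exact: ltW.
lra.
Qed.
End gaussian_comparison.

(** * The local limit estimate for a monotone sum *)

Section local_limit.
Context d (T : measurableType d) (R : realType) (Q : probability T R).
Variables (I : finType) (Y : I -> {RV Q >-> R}).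
Hypotheses (iY : forall i, int_valued (Y i)) (indepY : mutually_independent Y).
Hypothesis momY : forall i (c : R) n,
  Q.-integrable setT (EFin \o (fun w => `|Y i w - c| ^+ n)).
Local Open Scope complex_scope.

Let m i := \int[Q]_w Y i w.
Let s2 i := \int[Q]_w ((Y i w - m i) ^+ 2).
Let e3 i := \int[Q]_w (`|Y i w - m i| ^+ 3).
Let S : {RV Q >-> R} := \sum_i Y i.

Lemma expiD (x y : R) : expi (x + y) = expi x * expi y.
Proof. by rewrite /expi cosD sinD; simpc; congr (_ +i* _); ring. Qed.

Lemma expi_sum (J : Type) (r : seq J) (x : J -> R) :
  expi (\sum_(j <- r) x j) = \prod_(j <- r) expi (x j).
Proof.
elim: r => [|j r IH]; last by rewrite !big_cons expiD IH.
by rewrite !big_nil /expi cos0 sin0.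
Qed.

Lemma normc_expi (x : R) : normc (expi x) = 1.
Proof. by rewrite /normc /= cos2Dsin2 sqrtr1. Qed.

Lemma normr_normc (z : R[i]) : `|z| = (normc z)%:C.
Proof. by case: z. Qed.

Lemma normr_Re_le (z : R[i]) : `|complex.Re z| <= normc z.
Proof. by case: z => a b /=; rewrite -sqrtr_sqr ler_wsqrtr// lerDl sqr_ge0. Qed.

Let mY i : measurable_fun setT (Y i). Proof. by []. Qed.

Let mYm i : measurable_fun setT (fun w => Y i w - m i).
Proof. exact: measurable_funB. Qed.

Let intY i : Q.-integrable setT (EFin \o Y i).
Proof.
apply: le_integrable (momY i 0 1) => //; first exact/measurable_EFinP.
by move=> w _ /=; rewrite subr0 lee_fin expr1 normr_id.
Qed.

Let icst (c : R) : Q.-integrable setT (EFin \o (fun _ : T => c)).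
Proof. exact: (bounded_mfun_integrable Q (bounded_mfun_cst T _)). Qed.

Let centered i : \int[Q]_w (Y i w - m i) = 0.
Proof. by rewrite RintegralB// Rintegral_prob_cst subrr. Qed.

Let s2_ge0 i : 0 <= s2 i.
Proof. by apply: Rintegral_ge0 => w _; exact: sqr_ge0. Qed.

Let e3_ge0 i : 0 <= e3 i.
Proof. by apply: Rintegral_ge0 => w _; exact: exprn_ge0. Qed.

Variable t : int.
Hypothesis mean_t : \sum_i m i = t%:~R.
Let sg := Num.sqrt (\sum_i s2 i).
Let eta := \sum_i e3 i.
Hypothesis sg0 : 0 < sg.
Hypothesis monoS : monotone_rv S.

Let sgE : sg ^+ 2 = \sum_i s2 i.
Proof. by rewrite sqr_sqrtr// sumr_ge0. Qed.

Let sg2_le : sg ^+ 2 <= 2 * eta.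
Proof.
rewrite sgE /eta mulr_sumr; apply: ler_sum => i _.
apply: int_variance_le_abs3 => // n; exact: momY.
Qed.

Let eta0 : 0 < eta.
Proof. by have := exprn_gt0 2 sg0; move: sg2_le; lra. Qed.

Let F l := cexpectation Q (fun w => expi (l * (S w - t%:~R))).

Let SE w : S w - t%:~R = \sum_i (Y i w - m i).
Proof. by rewrite sumrB mean_t /S sum_RVE. Qed.

Let F_prod l : F l = \prod_i cexpectation Q (fun w => expi (l * (Y i w - m i))).
Proof.
rewrite -(indep_cprod indepY (h := fun i y => expi (l * (y - m i)))).
  congr cexpectation; apply/funext => w.
  by rewrite SE mulr_sumr expi_sum.
move=> i; apply: cbounded_mfun_expi; exact: measurable_funB.
Qed.

Let F_estimates l : 0 <= l ->
  normc (F l) <= expR (- ((sg * l) ^+ 2 / 2) + eta * l ^+ 3) /\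
  normc (F l - (expR (- ((sg * l) ^+ 2 / 2)))%:C) <=
    6 * (eta * l ^+ 3) * expR (- ((sg * l) ^+ 2 / 2) + eta * l ^+ 3).
Proof.
move=> l0.
have := @prod_charfun_estimates R I
  (fun i => cexpectation Q (fun w => expi (l * (Y i w - m i))))
  (fun i => l * Num.sqrt (s2 i)) (fun i => l ^+ 3 * e3 i).
rewrite -F_prod -mulr_sumr -/eta.
have -> : \sum_i (l * Num.sqrt (s2 i)) ^+ 2 = (sg * l) ^+ 2.
  rewrite exprMn sgE mulr_suml; apply: eq_bigr => i _.
  by rewrite exprMn sqr_sqrtr// mulrC.
rewrite [l ^+ 3 * _]mulrC; apply.
- by move=> i; rewrite mulr_ge0// sqrtr_ge0.
- move=> i; rewrite exprMn ler_wpM2l ?exprn_ge0//.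
  by apply: lyapunov_23 => // n; exact: momY.
- by move=> i; exact: normc_charfun_le1.
- by move=> i; apply: normc_charfun_taylor => // n; exact: momY.
Qed.

Let normc_F l : normc (F l) = normc (charfun S l).
Proof.
have -> : F l = expi (- (l * t%:~R)) * charfun S l.
  rewrite /charfun -cexpectationZ; last exact: cbounded_mfun_expi.
  by congr cexpectation; apply/funext => w; rewrite -expiD; congr expi; ring.
by rewrite normcM normc_expi mul1r.
Qed.

Lemma monotone_local_limit :
  `|pmf S t%:~R - 1 / (Num.sqrt (2 * pi) * sg)| <= 3160 * (eta ^+ 2 / sg ^+ 6).
Proof.
pose phi l := \int[Q]_w cos (l * (S w - t%:~R)).
have phiE l : phi l = complex.Re (F `|l|).
  rewrite /F cexpectationE /= /phi; apply: eq_Rintegral => w _.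
  by rewrite -[LHS]cos_norm -[RHS]cos_norm !normrM normr_id.
have iS : int_valued S.
  by move=> w; rewrite /S sum_RVE; apply: rpred_sum => i _; exact: iY.
have [iphi inv] := pmf_inversion t iS.
have pi0 := pi_gt0 R.
have -> : pmf S t%:~R = \int[lebesgue_measure]_(l in `[- pi, pi]) phi l / (2 * pi).
  by rewrite inv mulrC mulKf// gt_eqF// mulr_gt0.
apply: (gaussian_comparison (phi := phi) sg0 eta0 sg2_le iphi).
- move=> l _; rewrite phiE.
  have -> : (sg * l) ^+ 2 = (sg * `|l|) ^+ 2.
    by rewrite !exprMn (real_normK (num_real l)).
  apply: le_trans (F_estimates (normr_ge0 l)).2.
  by apply: le_trans (normr_Re_le _); rewrite raddfB.
- (* monotonicity brings the far region back to [eps] *)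
  move=> l le lpi; rewrite phiE.
  have eps0 : 0 <= sg ^+ 2 / (4 * eta) by rewrite divr_ge0 ?mulr_ge0 ?sqr_ge0// ltW.
  apply: le_trans (F_estimates eps0).1.
  apply: (le_trans (normr_Re_le _)); rewrite !normc_F.
  by have := monoS eps0 le lpi; rewrite !normr_normc lecR.
Qed.

End local_limit.

(** * Moments of independent sums *)

Section sums.
Context d (T : measurableType d) (R : realType) (Q : probability T R).

Lemma Rintegral_sum (J : Type) (r : seq J) (f : J -> T -> R) :
  (forall j, Q.-integrable setT (EFin \o f j)) ->
  \int[Q]_w (\sum_(j <- r) f j w) = \sum_(j <- r) \int[Q]_w f j w.
Proof.
move=> intf.
have ints (s : seq J) : Q.-integrable setT (EFin \o (fun w => \sum_(j <- s) f j w)).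
  have := @integrable_sum _ _ _ Q setT measurableT J s xpredT (fun j => EFin \o f j).
  move=> /(_ (fun j _ => intf j)); apply: eq_integrable => // w _.
  by rewrite /= sumEFin.
elim: r => [|j r IH].
  by under eq_Rintegral do rewrite big_nil; rewrite big_nil Rintegral_prob_cst.
under eq_Rintegral do rewrite big_cons.
by rewrite big_cons RintegralD// IH.
Qed.

Variables (I : finType) (Y : I -> {RV Q >-> R}).
Hypotheses (indepY : mutually_independent Y).

Lemma variance_sum_indep :
  (forall i (c : R) n, Q.-integrable setT (EFin \o (fun w => `|Y i w - c| ^+ n))) ->
  fine ('V_Q[\sum_i Y i : {RV Q >-> R}]) =
  \sum_i \int[Q]_w ((Y i w - \int[Q]_w Y i w) ^+ 2).
Proof.
move=> momY; pose m i := \int[Q]_w Y i w.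
have intc i c : Q.-integrable setT (EFin \o (fun w => Y i w - c)).
  apply: le_integrable (momY i c 1) => //.
    by apply/measurable_EFinP; exact: measurable_funB.
  by move=> w _ /=; rewrite lee_fin expr1 normr_id.
have int0 i : Q.-integrable setT (EFin \o Y i).
  by apply: eq_integrable (intc i 0) => // w _ /=; rewrite subr0.
have icst (c : R) : Q.-integrable setT (EFin \o (fun _ : T => c)).
  exact: (bounded_mfun_integrable Q (bounded_mfun_cst T _)).
have centered i : \int[Q]_w (Y i w - m i) = 0.
  by rewrite RintegralB// Rintegral_prob_cst subrr.
have mc i : measurable_fun setT (fun y : R => y - m i) by exact: measurable_funB.
have intp i j : Q.-integrable setT (EFin \o (fun w => (Y i w - m i) * (Y j w - m j))).
  have [<-|ij] := eqVneq i j.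
    by apply: eq_integrable (momY i (m i) 2) => // w _ /=; rewrite real_normK ?num_real.
  exact: (@indep_pair_integrable _ _ _ _ _ _ indepY i j ij
    (fun y => y - m i) (fun y => y - m j)).
have uncorr i j : i != j -> \int[Q]_w ((Y i w - m i) * (Y j w - m j)) = 0.
  move=> ij; rewrite (@indep_pair_Rintegral _ _ _ _ _ _ indepY i j ij
    (fun y => y - m i) (fun y => y - m j))//.
  by rewrite centered mul0r.
have ES : fine ('E_Q[\sum_i Y i : {RV Q >-> R}]) = \sum_i m i.
  rewrite unlock -[LHS]/(\int[Q]_w _) -Rintegral_sum//.
  by apply: eq_Rintegral => w _; rewrite sum_RVE.
rewrite /variance covariance.unlock ES expectation.unlock -[LHS]/(\int[Q]_w _).
transitivity (\int[Q]_w (\sum_i \sum_j (Y i w - m i) * (Y j w - m j))).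
  apply: eq_Rintegral => w _.
  transitivity (((\sum_i Y i : {RV Q >-> R}) w - \sum_i m i) *
                ((\sum_i Y i : {RV Q >-> R}) w - \sum_i m i)) => //.
  rewrite sum_RVE -sumrB mulr_suml.
  by apply: eq_bigr => i _; rewrite mulr_sumr.
rewrite Rintegral_sum; last first.
  move=> i; have := @integrable_sum _ _ _ Q setT measurableT I (index_enum I) xpredT
    (fun j => EFin \o (fun w => (Y i w - m i) * (Y j w - m j))).
  move=> /(_ (fun j _ => intp i j)); apply: eq_integrable => // w _.
  by rewrite /= sumEFin.
apply: eq_bigr => i _; rewrite Rintegral_sum// (bigD1 i)//= big1 ?addr0//.
by move=> j ji; rewrite uncorr// eq_sym.
Qed.

(** Replacing the other factors [expR (h * Y i)] by [Num.min 1] of them lowers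
    the expectation of the product, while keeping their expectations finite and
    positive. *)
Lemma mgf_sum_fin (h : R) (j : I) :
  ('M_Q ((\sum_i Y i)%R : {RV Q >-> R}) h < +oo)%E -> ('M_Q (Y j) h < +oo)%E.
Proof.
rewrite !mgfE => MS.
pose g i := if i == j then (fun y : R => expR (h * y))
            else (fun y : R => Num.min (expR (h * y)) 1).
have me : measurable_fun setT (fun y : R => expR (h * y)).
  by apply: measurableT_comp => //; exact: measurable_funM.
have mg i : measurable_fun setT (g i).
  by rewrite /g; case: ifP => // _; exact: measurable_minr.
have g_gt0 i y : 0 < g i y.
  by rewrite /g; case: ifP => _; rewrite ?lt_min ?ltr01 ?andbT expR_gt0.
have g_le i y : g i y <= expR (h * y).
  by rewrite /g; case: ifP => // _; rewrite ge_min lexx.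
have gfin i : i != j -> (\int[Q]_w (g i (Y i w))%:E < +oo)%E.
  move=> ij; apply: (@le_lt_trans _ _ (\int[Q]_w (1 : R)%:E)%E).
    apply: ge0_le_integral => //.
    - by move=> w _; rewrite lee_fin ltW.
    - by apply/measurable_EFinP; exact: measurableT_comp.
    - by move=> w _; rewrite lee_fin /g (negbTE ij) ge_min lexx orbT.
  by rewrite integral_cst//= probability_setT mule1 ltry.
have := indep_prod indepY mg (fun i y => ltW (g_gt0 i y)) gfin.
have gS : (\int[Q]_w (\prod_i g i (Y i w))%:E < +oo)%E.
  apply: le_lt_trans MS; apply: ge0_le_integral => //.
  - by move=> w _; rewrite lee_fin prodr_ge0// => i _; exact: ltW.
  - apply/measurable_EFinP; apply: measurable_prod => i _; exact: measurableT_comp.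
  - by apply/measurable_EFinP; exact: measurable_expRM.
  - move=> w _; rewrite lee_fin sum_RVE mulr_sumr expR_sum; apply: ler_prod => i _.
    by rewrite (ltW (g_gt0 i _)) g_le.
have gj : g j = fun y => expR (h * y) by rewrite /g eqxx.
rewrite [X in _ = X -> _](bigD1 j)//= gj => E; move: gS; rewrite E.
set x := (\int[Q]_w _)%E; set c := (\prod_(_ | _) _)%E.
have c0 : (0 < c)%E.
  rewrite /c; elim/big_ind : _ => // [a b|i _]; first exact: mule_gt0.
  by apply: integral_gt0 => //; exact: measurableT_comp.
have x0 : (0 <= x)%E by apply: integral_ge0 => w _; rewrite lee_fin expR_ge0.
by rewrite !ltey; apply: contraNN => /eqP ->; rewrite gt0_mulye.
Qed.

End sums.

(** * Mean and variance of a tilt *)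

Section tilted_variable.
Context d (T : measurableType d) d' (T' : measurableType d') (R : realType)
  (P : probability T R) (Q : probability T' R).
Variables (X : {RV P >-> R}) (theta : R) (Y : {RV Q >-> R}).
Hypotheses (iX : int_valued X) (tY : exp_tilt X theta Y).

Lemma exp_tilt_mgf_near : (mgf_dom X)° theta ->
  exists2 r, 0 < r & forall h, `|h| < r -> ('M_Q Y h < +oo)%E.
Proof.
move=> /nbhs_ballP[r /= r0 rX]; exists r => // h hr.
have Mh : ('M_P X (theta + h)%R < +oo)%E.
  by apply: rX; rewrite /ball /= opprD addNKr normrN.
rewrite (exp_tilt_mgf iX tY) muleC lte_mul_pinfty//.
by rewrite lee_fin invr_ge0 ltW// (exp_tilt_mgf_gt0 iX tY).
Qed.

(** By the inequality [1 + h (Y - m) <= expR (h (Y - m))] the cumulant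
    generating function of [Y], which is that of [X] recentred at [theta], lies
    above the line of slope the mean of [Y]. *)
Lemma exp_tilt_mean (t : R) : (mgf_dom X)° theta ->
  is_derive theta (1 : R) (log_mgf X) t -> \int[Q]_w Y w = t.
Proof.
move=> /exp_tilt_mgf_near[r r0 rY] dX; set m := (\int[Q]_w _)%R.
have r20 : 0 < r / 2 by rewrite divr_gt0.
have rr : `|r / 2| < r by rewrite gtr0_norm//; lra.
have iYc c : Q.-integrable setT (EFin \o (fun w => Y w - c)).
  have := mgf_integrable_pow c 1 r20 (rY _ rr) (rY (- (r / 2)) _).
  rewrite normrN => /(_ rr); apply: le_integrable => //.
    by apply/measurable_EFinP; exact: measurable_funB.
  by move=> w _ /=; rewrite lee_fin expr1 normr_id.
have iY : Q.-integrable setT (EFin \o Y).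
  by apply: eq_integrable (iYc 0) => // w _ /=; rewrite subr0.
apply/esym; apply: (is_derive_support_line r0 dX) => h hr.
have M0 := exp_tilt_mgf_gt0 iX tY.
have MY := exp_tilt_mgf iX tY h; have MYfin := rY h hr.
have MYgt0 := mgf_gt0 Y h.
have ME : fine ('M_Q Y h) = fine ('M_P X (theta + h)%R) / fine ('M_P X theta).
  have MXfin : ('M_P X (theta + h)%R < +oo)%E.
    move: MYfin; rewrite MY; case: ('M_P X _)%E => [z _|//|//]; first exact: ltry.
    by rewrite gt0_mulye// lte_fin invr_gt0.
  rewrite MY fineM// ge0_fin_numE//; exact/ltW/mgf_gt0.
have fY0 : 0 < fine ('M_Q Y h) by rewrite fine_gt0// MYgt0 MYfin.
have fX0 : 0 < fine ('M_P X (theta + h)%R).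
  by move: fY0; rewrite ME pmulr_lgt0// invr_gt0.
rewrite /log_mgf -ln_div ?posrE// -ME -[X in X <= _]expRK ler_ln ?posrE ?expR_gt0//.
have intE c : Q.-integrable setT (EFin \o (fun w => c * expR (h * Y w))).
  have ie : Q.-integrable setT (EFin \o (fun w => expR (h * Y w))).
    apply/integrableP; split; first by apply/measurable_EFinP; exact: measurable_expRM.
    under eq_integral do rewrite /= ger0_norm ?expR_ge0//.
    by rewrite -mgfE.
  by have := integrableZl measurableT c ie.
have -> : fine ('M_Q Y h) = \int[Q]_w expR (h * Y w) by rewrite mgfE.
have ihc := integrableZl measurableT h (iYc m).
have ic1 : Q.-integrable setT (EFin \o (fun _ : T' => 1 : R)).
  exact: (bounded_mfun_integrable Q (bounded_mfun_cst T' _)).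
have jensen : 1 <= \int[Q]_w (expR (- (h * m)) * expR (h * Y w)).
  have {1}-> : 1 = \int[Q]_w (1 + h * (Y w - m)).
    rewrite RintegralD// RintegralZl// RintegralB//; last first.
      exact: (bounded_mfun_integrable Q (bounded_mfun_cst T' _)).
    by rewrite !Rintegral_prob_cst subrr mulr0 addr0.
  apply: le_Rintegral => //.
    by have := integrableD measurableT ic1 ihc.
  move=> w _; rewrite -expRD.
  apply: le_trans (expR_ge1Dx _); rewrite lerD2l; lra.
move: jensen; rewrite RintegralZl//; last first.
  by apply: eq_integrable (intE 1) => // w _ /=; rewrite mul1r.
by rewrite expRN mulrC ler_pdivlMr ?expR_gt0// mul1r.
Qed.

(** If the variance vanishes, the integer-valued [Y] sits at its mean, and so
    does [X] since the tilting density is positive. *)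
Lemma exp_tilt_variance_gt0 (t : int) :
  Q.-integrable setT (EFin \o (fun w => (Y w - t%:~R) ^+ 2)) ->
  ~ (exists a : R, {ae P, forall w, X w = a}) ->
  0 < \int[Q]_w ((Y w - t%:~R) ^+ 2).
Proof.
move=> i2 Xcst; have [iY _] := tY.
rewrite lt_neqAle Rintegral_ge0 ?andbT; last by move=> w _; exact: sqr_ge0.
apply/eqP => /esym V0; apply: Xcst; exists t%:~R.
pose g (y : R) := \1_(~` [set (t%:~R : R)]) y : R.
have mg : measurable_fun setT g by apply: measurable_indic; exact: measurableC.
have g0 y : 0 <= g y by rewrite /g indicE.
have Qg : (\int[Q]_w (g (Y w))%:E = 0)%E.
  apply/eqP; rewrite eq_le integral_ge0 ?andbT; last by move=> w _; rewrite lee_fin.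
  apply: (@le_trans _ _ (\int[Q]_w ((Y w - t%:~R) ^+ 2)%:E)%E).
    apply: ge0_le_integral => //.
    - by move=> w _; rewrite lee_fin.
    - by apply/measurable_EFinP; exact: (measurableT_comp mg).
    - apply/measurable_EFinP; apply: measurable_funX; exact: measurable_funB.
    - move=> w _; rewrite lee_fin /g indicE.
      have [Yt|/eqP Yt] := eqVneq (Y w) t%:~R.
        by rewrite Yt memNset ?subrr ?sqr_ge0// => /(_ erefl).
      have /intrP[k Yk] := iY w; rewrite Yk -rmorphB /= in Yt *.
      have kt : (k - t)%R != 0 by rewrite subr_eq0; apply/eqP => kt; apply: Yt; rewrite kt.
      apply: (@le_trans _ _ 1); first by case: (_ \in _).
      rewrite -rmorphXn /= -[1]/(1%:~R) ler_int.
      by rewrite -gtz0_ge1 lt_neqAle sqr_ge0 andbT eq_sym sqrf_eq0.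
  have /fineK <- := integrable_fin_num measurableT i2.
  by rewrite -[X in X%:E]/(\int[Q]_w ((Y w - t%:~R) ^+ 2)) V0.
have M0 := exp_tilt_mgf_gt0 iX tY.
pose f w := g (X w) * (expR (theta * X w) / fine ('M_P X theta)).
have mf : measurable_fun setT (EFin \o f).
  apply/measurable_EFinP; apply: measurable_funM; first exact: (measurableT_comp mg).
  by apply: measurable_funM => //; exact: measurable_expRM.
have f0 w : 0 <= f w by rewrite mulr_ge0// divr_ge0 ?expR_ge0// ltW.
have [+ _] := ae_eq_integral_abs P measurableT mf.
have -> : (\int[P]_w `|(EFin \o f) w| = 0)%E.
  rewrite -Qg (exp_tilt_integral iX tY)//; apply: eq_integral => w _ /=.
  by rewrite ger0_norm.
move=> /(_ erefl); apply: filterS => w /= /(_ I) [] /eqP.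
have d0 : 0 < expR (theta * X w) / fine ('M_P X theta) by rewrite divr_gt0 ?expR_gt0.
rewrite /f mulf_eq0 (gt_eqF d0) orbF /g indicE => gX; apply: contrapT => Xt.
by move: gX; rewrite mem_set// oner_eq0.
Qed.

End tilted_variable.

Theorem theorem2 (R : realType) :
  exists c : R, 0 < c /\
  forall (k : nat) (hk : (1 <= k)%N)
    (d : measure_display) (T : measurableType d) (P : probability T R)
    (Xs : 'I_k -> {RV P >-> R}),
    (forall j, int_valued (Xs j)) ->
    mutually_independent Xs ->
    let X : {RV P >-> R} := \sum_(j < k) Xs j in
    strongly_monotone X ->
    ~ (exists a : R, {ae P, forall w, X w = a}) ->
    mgf_dom X <> [set 0] ->
  forall t : int,
    (ess_inf P (EFin \o X) < (t%:~R)%:E)%E ->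
    ((t%:~R)%:E < ess_sup P (EFin \o X))%E ->
  forall theta : R,
    (mgf_dom X)° theta ->
    is_derive theta (1 : R) (log_mgf X) t%:~R ->
  forall (d' : measure_display) (T' : measurableType d')
    (Q : probability T' R) (Ys : 'I_k -> {RV Q >-> R}),
    mutually_independent Ys ->
    (forall j, exp_tilt (Xs j) theta (Ys j)) ->
    let Y : {RV Q >-> R} := \sum_(j < k) Ys j in
    let M : R := fine ('M_P X theta) / expR (theta * t%:~R) in
    [/\ exp_tilt X theta Y,
        ('E_Q[Y] = (t%:~R)%:E)%E &
        `|pmf X t%:~R - M * (1 / (Num.sqrt (2 * pi) * std_dev Y))| <=
          c * M * (sum_abs_central_mmt3 Ys ^+ 2 / std_dev Y ^+ 6)].
Proof.
exists 3160; split; first by rewrite ltr0n.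
move=> k hk d T P Xs iXs indepX X smX Xcst _ t _ _ theta th_int dlog d' T' Q Ys indepY tYs Y M.
have iYs j : int_valued (Ys j) by case: (tYs j).
have iX : int_valued X.
  by move=> w; rewrite /X sum_RVE; apply: rpred_sum => j _; exact: iXs.
have tY : exp_tilt X theta Y by exact: exp_tilt_sum.
have [r r0 rY] := exp_tilt_mgf_near iX tY th_int.
have r20 : 0 < r / 2 by rewrite divr_gt0.
have rr : `|r / 2| < r by rewrite gtr0_norm//; lra.
have rNr : `|- (r / 2)| < r by rewrite normrN.
have momYs j (c : R) n : Q.-integrable setT (EFin \o (fun w => `|Ys j w - c| ^+ n)).
  by apply: (mgf_integrable_pow (r := r / 2)) => //; apply: mgf_sum_fin => //; exact: rY.
have momY (c : R) n : Q.-integrable setT (EFin \o (fun w => `|Y w - c| ^+ n)).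
  by apply: (mgf_integrable_pow (r := r / 2)) => //; exact: rY.
have mean_t : \int[Q]_w Y w = t%:~R by exact: exp_tilt_mean iX tY _ th_int dlog.
have int1 (Z : {RV Q >-> R}) :
    (forall (c : R) n, Q.-integrable setT (EFin \o (fun w => `|Z w - c| ^+ n))) ->
    Q.-integrable setT (EFin \o Z).
  move=> momZ; apply: le_integrable (momZ 0 1) => //; first exact/measurable_EFinP.
  by move=> w _ /=; rewrite subr0 lee_fin expr1 normr_id.
have intY := int1 Y momY.
have EYs : \sum_j \int[Q]_w Ys j w = t%:~R.
  rewrite -mean_t -Rintegral_sum; last by move=> j; apply: int1; exact: momYs.
  by apply: eq_Rintegral => w _; rewrite /Y sum_RVE.
have meanY : ('E_Q[Y] = (t%:~R)%:E)%E.
  rewrite expectation.unlock -[LHS]fineK; last exact: (integrable_fin_num measurableT intY).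
  by congr EFin; exact: mean_t.
have varY : fine ('V_Q[Y]) = \sum_j \int[Q]_w ((Ys j w - \int[Q]_w Ys j w) ^+ 2).
  exact: variance_sum_indep.
have varY_gt0 : 0 < fine ('V_Q[Y]).
  rewrite (_ : fine _ = \int[Q]_w ((Y w - t%:~R) ^+ 2)).
    apply: (exp_tilt_variance_gt0 iX tY) => //.
    by apply: eq_integrable (momY t%:~R 2) => // w _ /=; rewrite real_normK ?num_real.
  rewrite /variance covariance.unlock meanY expectation.unlock.
  by apply: eq_Rintegral => w _.
have monoY : monotone_rv Y.
  by apply: (smX.2 theta _ _ _ _ _ tY); exact: interior_subset.
have sdE : std_dev Y = Num.sqrt (\sum_j \int[Q]_w ((Ys j w - \int[Q]_w Ys j w) ^+ 2)).
  by rewrite /std_dev varY.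
have etaE : sum_abs_central_mmt3 Ys =
    \sum_j \int[Q]_w (`|Ys j w - \int[Q]_w Ys j w| ^+ 3).
  by apply: eq_bigr => j _; rewrite expectation.unlock.
have M0 : 0 < M by rewrite divr_gt0 ?expR_gt0// (exp_tilt_mgf_gt0 iX tY).
split => //.
have -> : pmf X t%:~R = M * pmf Y t%:~R.
  rewrite tY.2 /M; field.
  by rewrite !gt_eqF ?expR_gt0// (exp_tilt_mgf_gt0 iX tY).
rewrite -mulrBr normrM (gtr0_norm M0).
rewrite -[leRHS]mulrA [leRHS]mulrCA ler_pM2l//.
rewrite sdE etaE; apply: monotone_local_limit => //.
by rewrite sqrtr_gt0 -varY.
Qed.
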